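(* Let $\mathcal{A}=\mathcal{A}_n^{\bar q,\Lambda}(\mathbb{K})$ and suppose $q_1,\dots,q_n$ are multiplicatively independent, i.e. $q_1^{i_1}q_2^{i_2}\cdots q_n^{i_n}=1$ with $i_1,\dots,i_n\in\mathbb{Z}$ implies $i_1=\cdots=i_n=0$. Then every $\mathbb{K}$-algebra endomorphism of the localization $\mathcal{A}_{\mathcal{Z}}$ is a $\mathbb{K}$-algebra automorphism.
   Context: Let $\mathbb{K}$ be a field, $n\ge 1$, $\bar q=(q_1,\dots,q_n)\in(\mathbb{K}^* )^n$, and $\Lambda=(\lambda_{ij})$ an $n\times n$ matrix over $\mathbb{K}^*$ with $\lambda_{ij}=\lambda_{ji}^{-1}$, $\lambda_{ii}=1$. $\mathcal{A}_n^{\bar q,\Lambda}(\mathbb{K})$ is the $\mathbb{K}$-algebra generated by $x_1,y_1,\dots,x_n,y_n$ with relations: for $1\le i<j\le n$, $x_ix_j=\lambda_{ij}x_jx_i$, $y_jy_i=\lambda_{ji}y_iy_j$, $x_iy_j=\lambda_{ji}y_jx_i$, $x_jy_i=\lambda_{ij}y_ix_j$; and $x_iy_i-q_iy_ix_i=1$ for all $i$. Put $z_i=x_iy_i-y_ix_i$; these are pairwise commuting normal elements ($z_iy_i=q_iy_iz_i$, $z_ix_i=q_i^{-1}x_iz_i$, $z_i$ commutes with $x_j,y_j$ for $j\ne i$). $\mathcal{Z}$ is the multiplicative submonoid of $\mathcal{A}$ generated by $z_1,\dots,z_n$ (an Ore set), and $\mathcal{A}_{\mathcal{Z}}$ is the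 localization of $\mathcal{A}$ at $\mathcal{Z}$. *)

(* Defs.v *)
From HB Require Import structures.
From mathcomp Require Import all_boot all_order all_algebra.
Set Implicit Arguments. Unset Strict Implicit. Unset Printing Implicit Defensive.
Import Order.TTheory GRing.Theory Num.Theory.
Local Open Scope ring_scope.

Definition is_alg_hom (K : fieldType) (A C : algType K) (f : A -> C) : Prop :=
  [/\ forall (a : K) (u v : A), f (a *: u + v) = a *: f u + f v,
      f 1 = 1 &
      forall u v : A, f (u * v) = f u * f v].

Definition invertible (A : pzRingType) (u : A) : Prop :=
  exists v : A, u * v = 1 /\ v * u = 1.

Definition qweyl_rel (K : fieldType) (n : nat) (q : 'I_n -> K)
    (lam : 'I_n -> 'I_n -> K) (C : algType K) (x y : 'I_n -> C) : Prop :=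
  (forall i j : 'I_n, (i < j)%N ->
      [/\ x i * x j = lam i j *: (x j * x i),
          y j * y i = lam j i *: (y i * y j),
          x i * y j = lam j i *: (y j * x i) &
          x j * y i = lam i j *: (y i * x j)]) /\
  (forall i : 'I_n, x i * y i - q i *: (y i * x i) = 1).

Definition zgen (K : fieldType) (n : nat) (C : algType K) (x y : 'I_n -> C)
    (i : 'I_n) : C := x i * y i - y i * x i.

(* (B, x, y) is the localization A_Z of A = A_n^{q,Lambda}(K) at the Ore set Z
   generated by z_1..z_n, characterized by its universal property:
   the generators satisfy the relations, the z_i are invertible, and for every
   K-algebra C with elements X_i, Y_i satisfying the relations and with the
   Z_i invertible there is a unique K-algebra homomorphism B -> C sending
   x_i |-> X_i and y_i |-> Y_i. *)
Definition is_qweyl_localization (K : fieldType) (n : nat) (q : 'I_n -> K)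
    (lam : 'I_n -> 'I_n -> K) (B : algType K) (x y : 'I_n -> B) : Prop :=
  [/\ qweyl_rel q lam x y,
      (forall i, invertible (zgen x y i)) &
      forall (C : algType K) (X Y : 'I_n -> C),
        qweyl_rel q lam X Y ->
        (forall i, invertible (zgen X Y i)) ->
        exists g : B -> C,
          [/\ is_alg_hom g, (forall i, g (x i) = X i), (forall i, g (y i) = Y i) &
              forall g' : B -> C, is_alg_hom g' ->
                (forall i, g' (x i) = X i) -> (forall i, g' (y i) = Y i) ->
                forall u, g' u = g u]].

(* Main.v *)
Require Import Defs.
From HB Require Import structures.
From mathcomp Require Import all_boot all_order all_algebra.
From mathcomp Require Import boolp.
From mathcomp Require Import zify ring.
Set Implicit Arguments. Unset Strict Implicit. Unset Printing Implicit Defensive.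
Import Order.TTheory GRing.Theory Num.Theory.
Local Open Scope ring_scope.

(**
The algebra acts on functions on the lattice Z^n: y_i and x_i shift the i-th coordinate up
and down, and z_i multiplies by q_i^{m_i}. This embeds it into the quantum torus spanned by
the monomials z^a y^d, whose only units are scalar multiples of monomials. A unit of the
localization and its inverse both preserve the functions supported on N^n, so d = 0 and the
units of the localization are c z^a. Hence an endomorphism f maps z_k to c_k z^{a_k}, and the
commutation of z_k with y_i and x_i together with the independence of the q_i forces
f(z_k) = c_k z_k^{e_k} with e_k = 1 or -1, while f(y_i) = A w and f(x_i) = A' w', where
(w, w') = (y_i, x_i) or (x_i, y_i) and A, A' are Laurent polynomials in the z_j. Comparing
both sides of (q_i - 1) f(y_i) f(x_i) = f(z_i) - 1 shows that A and A' are monomials up to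
scalars, so the image of f contains all generators. Injectivity holds because f maps the
basis of normal monomials to elements of distinct degrees and weights.
*)

(** * Linear operators on spaces of functions *)

(** The algebra is known only through its universal property, which yields homomorphisms out of it
    but no basis. The representation supplies what is missing: normal monomials span by rewriting,
    and their images are independent because they shift by distinct degrees or carry distinct
    characters of the lattice. Acting on all of Z^n rather than N^n makes the y_i invertible, hence
    the quantum torus with its rigid units; N^n survives as an invariant region because the weight
    of x_i contains the q-number of m_i + 1, which is zero at m_i = -1.

    The obstacle in the comparison of f(y_i) f(x_i) with f(z_i) - 1 is that x_i y_i and y_i x_i act
    by weights with zeros, so they cannot be inverted. These zeros fill a single hyperplane, so the
    weights are nonzero once every coordinate is large, and sampling far out along the diagonal is
    enough both for independence and for cancellation. The same zeros determine c_k: it is 1 when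
    e_k = 1 and 1/q_k when e_k = -1. *)

Section LinearOperators.
Variables (K : fieldType) (G : zmodType).

Record linop := Linop {
  linop_fun :> (G -> K) -> G -> K;
  linop_linear : forall (c : K) (F H : G -> K) (m : G),
    linop_fun (fun t => c * F t + H t) m = c * linop_fun F m + linop_fun H m }.

Lemma linop_ext (A D : linop) : (forall F m, A F m = D F m) -> A = D.
Proof.
case: A D => [a la] [b lb] /= ab.
have {}ab : a = b by apply/funext => F; apply/funext => m; apply: ab.
by rewrite {}ab in la *; rewrite (Prop_irrelevance la lb).
Qed.

Lemma linop_eqfun (A : linop) F H : F =1 H -> A F =1 A H.
Proof. by move=> /funext ->. Qed.

HB.instance Definition _ := gen_eqMixin linop.
HB.instance Definition _ := gen_choiceMixin linop.

Program Definition linop_zero := @Linop (fun _ _ => 0) _.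
Next Obligation. by rewrite mulr0 addr0. Qed.
Program Definition linop_add (A D : linop) := @Linop (fun F m => A F m + D F m) _.
Next Obligation. by rewrite !linop_linear mulrDr addrACA. Qed.
Program Definition linop_opp (A : linop) := @Linop (fun F m => - A F m) _.
Next Obligation. by rewrite linop_linear opprD mulrN. Qed.
Program Definition linop_scale (a : K) (A : linop) := @Linop (fun F m => a * A F m) _.
Next Obligation. by rewrite linop_linear mulrDr mulrCA. Qed.
Program Definition linop_one := @Linop (fun F m => F m) _.
Program Definition linop_mul (A D : linop) := @Linop (fun F m => A (D F) m) _.
Next Obligation.
rewrite -linop_linear.
by apply: linop_eqfun => t; rewrite linop_linear.
Qed.

Lemma linop_addA : associative linop_add.
Proof. by move=> A D E; apply: linop_ext => F m /=; rewrite addrA. Qed.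
Lemma linop_addC : commutative linop_add.
Proof. by move=> A D; apply: linop_ext => F m /=; rewrite addrC. Qed.
Lemma linop_add0 : left_id linop_zero linop_add.
Proof. by move=> A; apply: linop_ext => F m /=; rewrite add0r. Qed.
Lemma linop_addN : left_inverse linop_zero linop_opp linop_add.
Proof. by move=> A; apply: linop_ext => F m /=; rewrite addNr. Qed.

HB.instance Definition _ :=
  GRing.isZmodule.Build linop linop_addA linop_addC linop_add0 linop_addN.

Lemma linop_mulA : associative linop_mul.
Proof. by move=> A D E; apply: linop_ext. Qed.
Lemma linop_mul1l : left_id linop_one linop_mul.
Proof. by move=> A; apply: linop_ext. Qed.
Lemma linop_mul1r : right_id linop_one linop_mul.
Proof. by move=> A; apply: linop_ext. Qed.
Lemma linop_mulDl : left_distributive linop_mul +%R.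
Proof. by move=> A D E; apply: linop_ext. Qed.
Lemma linop_mulDr : right_distributive linop_mul +%R.
Proof.
move=> A D E; apply: linop_ext => F m /=.
rewrite -[A (D F) m]mul1r -linop_linear.
by apply: linop_eqfun => t; rewrite mul1r.
Qed.
Lemma linop_one_neq0 : linop_one != 0.
Proof.
apply/eqP => /(congr1 (fun A : linop => A (fun=> 1) 0)) /= /eqP.
by rewrite oner_eq0.
Qed.

HB.instance Definition _ := GRing.Zmodule_isNzRing.Build linop
  linop_mulA linop_mul1l linop_mul1r linop_mulDl linop_mulDr linop_one_neq0.

Lemma linop_scaleA a b A : linop_scale a (linop_scale b A) = linop_scale (a * b) A.
Proof. by apply: linop_ext => F m /=; rewrite mulrA. Qed.
Lemma linop_scale1 : left_id 1 linop_scale.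
Proof. by move=> A; apply: linop_ext => F m /=; rewrite mul1r. Qed.
Lemma linop_scaleDr : right_distributive linop_scale +%R.
Proof. by move=> a A D; apply: linop_ext => F m /=; rewrite mulrDr. Qed.
Lemma linop_scaleDl A : {morph linop_scale^~ A : a b / a + b}.
Proof. by move=> a b; apply: linop_ext => F m /=; rewrite mulrDl. Qed.

HB.instance Definition _ := GRing.Zmodule_isLmodule.Build K linop
  linop_scaleA linop_scale1 linop_scaleDr linop_scaleDl.

Lemma linop_scaleAl (a : K) (A D : linop) : a *: (A * D) = (a *: A) * D.
Proof. exact: linop_ext. Qed.

HB.instance Definition _ := GRing.Lmodule_isLalgebra.Build K linop linop_scaleAl.

Lemma linop_scaleAr (a : K) (A D : linop) : a *: (A * D) = A * (a *: D).
Proof.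
apply: linop_ext => F m /=.
have A0 : A (fun=> 0) m = 0.
  apply: (@addrI _ (A (fun=> 0) m)); rewrite addr0 -[X in X + _]mul1r -linop_linear.
  by apply: linop_eqfun => t; rewrite mul1r addr0.
rewrite -[LHS]addr0 -A0 -linop_linear.
by apply: linop_eqfun => t; rewrite /= addr0.
Qed.

HB.instance Definition _ := GRing.Lalgebra_isAlgebra.Build K linop linop_scaleAr.

Lemma linopDE (A D : linop) F m : (A + D) F m = A F m + D F m. Proof. by []. Qed.
Lemma linopME (A D : linop) F m : (A * D) F m = A (D F) m. Proof. by []. Qed.
Lemma linopZE a (A : linop) F m : (a *: A) F m = a * A F m. Proof. by []. Qed.

Lemma linop_sumE (I : Type) (s : seq I) (P : pred I) (A : I -> linop) F m :
  (\sum_(i <- s | P i) A i) F m = \sum_(i <- s | P i) A i F m.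
Proof. by elim/big_rec2: _ => // i a D _ <-; rewrite linopDE. Qed.

End LinearOperators.

(** * Algebra homomorphisms *)

Section AlgHom.
Variables (K : fieldType) (A C : algType K) (f : A -> C) (hf : is_alg_hom f).
Lemma alg_homD u v : f (u + v) = f u + f v.
Proof. by case: hf => fl _ _; have := fl 1 u v; rewrite !scale1r. Qed.
Lemma alg_hom1 : f 1 = 1. Proof. by case: hf. Qed.
Lemma alg_homM u v : f (u * v) = f u * f v. Proof. by case: hf. Qed.
Lemma alg_hom0 : f 0 = 0.
Proof. by apply: (@addrI _ (f 0)); rewrite -alg_homD !addr0. Qed.
Lemma alg_homZ a u : f (a *: u) = a *: f u.
Proof. by case: hf => fl _ _; have := fl a u 0; rewrite !addr0 alg_hom0 addr0. Qed.
Lemma alg_homN u : f (- u) = - f u.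
Proof. by rewrite -scaleN1r alg_homZ scaleN1r. Qed.
Lemma alg_homB u v : f (u - v) = f u - f v.
Proof. by rewrite alg_homD alg_homN. Qed.
Lemma alg_hom_sum (I : Type) (s : seq I) (P : pred I) (F : I -> A) :
  f (\sum_(i <- s | P i) F i) = \sum_(i <- s | P i) f (F i).
Proof. by apply: (big_morph f alg_homD alg_hom0). Qed.
Lemma alg_hom_prod (I : Type) (s : seq I) (P : pred I) (F : I -> A) :
  f (\prod_(i <- s | P i) F i) = \prod_(i <- s | P i) f (F i).
Proof. by apply: (big_morph f alg_homM alg_hom1). Qed.
End AlgHom.

Lemma alg_hom_comp (K : fieldType) (A C D : algType K) (g : C -> D) (f : A -> C) :
  is_alg_hom g -> is_alg_hom f -> is_alg_hom (g \o f).
Proof.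
move=> hg hf; split=> [a u v||u v] /=.
- by rewrite (alg_homD hf) (alg_homZ hf) (alg_homD hg) (alg_homZ hg).
- by rewrite (alg_hom1 hf) (alg_hom1 hg).
- by rewrite (alg_homM hf) (alg_homM hg).
Qed.

(** * Induction over a localization presented by its universal property *)

Definition subalg_prop (K : fieldType) (B : algType K) (P : B -> Prop) : Prop :=
  [/\ P 1, forall (a : K) u v, P u -> P v -> P (a *: u + v) &
      forall u v, P u -> P v -> P (u * v)].

Section Subalgebra.
Variables (K : fieldType) (B : algType K) (P : B -> Prop) (hP : subalg_prop P).

Definition subalg_pred : {pred B} := fun u => `[< P u >].

Lemma subalg_pred_closed : subalg_closed subalg_pred.
Proof.
case: hP => h1 hD hM; split=> [|a u v|u v]; rewrite /subalg_pred !unfold_in.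
- exact/asboolP.
- by move=> /asboolP hu /asboolP hv; apply/asboolP/hD.
- by move=> /asboolP hu /asboolP hv; apply/asboolP/hM.
Qed.

HB.instance Definition _ := GRing.isSubalgClosed.Build K B subalg_pred subalg_pred_closed.

Record subalg := Subalg { subalg_val :> B; subalg_valP : subalg_val \in subalg_pred }.

HB.instance Definition _ := [isSub for subalg_val].
HB.instance Definition _ := [Choice of subalg by <:].
HB.instance Definition _ := [SubChoice_isSubZmodule of subalg by <:].
HB.instance Definition _ := [SubZmodule_isSubNzRing of subalg by <:].
HB.instance Definition _ := [SubZmodule_isSubLmodule of subalg by <:].
HB.instance Definition _ := [SubNzRing_SubLmodule_isSubLalgebra of subalg by <:].
HB.instance Definition _ := [SubLalgebra_isSubAlgebra of subalg by <:].

Definition subalgType : algType K := subalg.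

(** The universal property maps [B] into the subalgebra cut out by [P]; followed by the inclusion,
    this fixes the generators and is the identity by uniqueness. The inverses [zi] must satisfy [P]
    so that the z_i are invertible inside the subalgebra. *)
Lemma qweyl_localization_ind (n : nat) (q : 'I_n -> K) (lam : 'I_n -> 'I_n -> K)
    (x y zi : 'I_n -> B) :
  is_qweyl_localization q lam x y ->
  (forall i, zgen x y i * zi i = 1) -> (forall i, zi i * zgen x y i = 1) ->
  (forall i, P (x i)) -> (forall i, P (y i)) -> (forall i, P (zi i)) ->
  forall u, P u.
Proof.
case=> -[rel1 rel2] _ univ zzi ziz Px Py Pzi u.
pose mk v (hv : P v) : subalgType := Subalg (asboolT hv : v \in subalg_pred).
pose X i := mk _ (Px i); pose Y i := mk _ (Py i).
have valI : injective (val : subalgType -> B) by exact: val_inj.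
have rel : qweyl_rel q lam X Y.
  split=> [i j ij|i]; last by apply: valI; apply: rel2.
  by case: (rel1 i j ij) => r1 r2 r3 r4; split; apply: valI.
have inv i : invertible (zgen X Y i).
  by exists (mk _ (Pzi i)); split; apply: valI; [apply: zzi|apply: ziz].
have [g [hg gx gy _]] := univ subalgType X Y rel inv.
have invB i : invertible (zgen x y i) by exists (zi i).
have [h [_ _ _ huniq]] := univ B x y (conj rel1 rel2) invB.
have hv : is_alg_hom (fun v => val (g v) : B).
  by case: hg => gl g1 gm; split=> [a v w||v w]; rewrite ?gl ?g1 ?gm.
have -> : u = val (g u).
  rewrite (huniq _ hv) => [|i|i]; rewrite ?gx ?gy //.
  by rewrite -(huniq (fun v => v)).
by have /asboolP := subalg_valP (g u).
Qed.

End Subalgebra.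

(** * Formal linear combinations *)

Section Lincomb.
Variables (K : fieldType) (I : eqType).
Implicit Types (s t : seq (K * I)) (i : I).

Definition coef s i : K := \sum_(p <- s | p.2 == i) p.1.
Definition supp s : seq I := [seq i <- undup [seq p.2 | p <- s] | coef s i != 0].
Definition lincomb (V : lmodType K) (b : I -> V) s : V := \sum_(p <- s) p.1 *: b p.2.
Definition spanned (V : lmodType K) (b : I -> V) (u : V) := exists s, u = lincomb b s.
(** A list may repeat an index, so freeness is a statement about collected coefficients. It also
    forces [b] to be injective. *)
Definition linfree (V : lmodType K) (b : I -> V) :=
  forall s, lincomb b s = 0 -> forall i, coef s i = 0.

Lemma supp_uniq s : uniq (supp s).
Proof. by rewrite filter_uniq ?undup_uniq. Qed.

Lemma mem_supp s i : (i \in supp s) = (coef s i != 0).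
Proof.
rewrite mem_filter mem_undup andb_idr // => /negP ci.
apply/negPn/negP => ni; apply: ci; rewrite /coef big_seq_cond big1 // => p.
by case/andP=> ps /eqP pi; rewrite -pi map_f in ni.
Qed.

Variables (V : lmodType K).
Implicit Types (b : I -> V).

Lemma lincombE b s : lincomb b s = \sum_(i <- supp s) coef s i *: b i.
Proof.
rewrite /supp big_filter big_mkcond /= /lincomb.
transitivity (\sum_(i <- undup [seq p.2 | p <- s]) coef s i *: b i); last first.
  by apply: eq_bigr => i _; case: eqP => //= ->; rewrite scale0r.
transitivity (\sum_(i <- undup [seq p.2 | p <- s])
   \sum_(p <- s | p.2 == i) p.1 *: b p.2); last first.
  by apply: eq_bigr => i _; rewrite /coef scaler_suml; apply: eq_bigr => p /eqP ->.
under [RHS]eq_bigr do rewrite big_mkcond.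
rewrite exchange_big /= big_seq [RHS]big_seq; apply: eq_bigr => p ps.
rewrite -big_mkcond /= -big_filter.
rewrite (@eq_filter _ _ (pred1 p.2)); last by move=> i; rewrite /= eq_sym.
by rewrite filter_pred1_uniq ?undup_uniq ?big_seq1 // mem_undup map_f.
Qed.

Lemma lincomb_coef0 b s : (forall i, coef s i = 0) -> lincomb b s = 0.
Proof.
move=> c0; rewrite lincombE; case E: (supp s) => [|i r]; first by rewrite big_nil.
by have := mem_supp s i; rewrite E inE eqxx c0 eqxx.
Qed.

Lemma lincomb_cat b s t : lincomb b (s ++ t) = lincomb b s + lincomb b t.
Proof. by rewrite /lincomb big_cat. Qed.

Lemma spanned_lin b (a : K) u v :
  spanned b u -> spanned b v -> spanned b (a *: u + v).
Proof.
move=> [s ->] [t ->]; exists ([seq (a * p.1, p.2) | p <- s] ++ t).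
rewrite lincomb_cat /lincomb big_map scaler_sumr; congr (_ + _).
by apply: eq_bigr => p _; rewrite scalerA.
Qed.

Lemma spanned0 b : spanned b 0.
Proof. by exists [::]; rewrite /lincomb big_nil. Qed.

Lemma spannedZ b a u : spanned b u -> spanned b (a *: u).
Proof. by move=> hu; rewrite -[_ *: _]addr0; apply: spanned_lin => //; apply: spanned0. Qed.

Lemma spannedD b u v : spanned b u -> spanned b v -> spanned b (u + v).
Proof. by rewrite -{2}[u]scale1r; apply: spanned_lin. Qed.

Lemma spannedB b u v : spanned b u -> spanned b v -> spanned b (u - v).
Proof. by move=> hu hv; rewrite addrC -scaleN1r; apply: spanned_lin. Qed.

Lemma spanned_basis b i : spanned b (b i).
Proof. by exists [:: (1, i)]; rewrite /lincomb big_seq1 scale1r. Qed.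

Lemma spanned_sum (J : Type) b (r : seq J) (F : J -> V) :
  (forall j, spanned b (F j)) -> spanned b (\sum_(j <- r) F j).
Proof.
by move=> h; elim/big_ind: _ => //; [apply: spanned0|apply: spannedD].
Qed.

End Lincomb.

Lemma spanned_ind (K : fieldType) (I : eqType) (V W : lmodType K) (b : I -> V)
    (b' : I -> W) (g : V -> W) :
  (forall a u v, g (a *: u + v) = a *: g u + g v) ->
  (forall i, exists t, g (b i) = lincomb b' t) ->
  forall u, spanned b u -> spanned b' (g u).
Proof.
move=> gl gb u [s ->]; rewrite /lincomb.
have g0 : g 0 = 0.
  apply: (@addrI _ (g 0)); rewrite addr0 -{1}[g 0]scale1r -gl.
  by rewrite scale1r addr0.
elim: s => [|p s IH]; first by rewrite big_nil g0; apply: spanned0.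
by rewrite big_cons gl; apply: spanned_lin => //; apply: gb.
Qed.

(* Pairing with the polynomial vanishing at the other values [Q p'] isolates [c]. *)
Lemma power_sum_coef0 (K : fieldType) (J : Type) (r : seq J) (w Q : J -> K)
    (N0 : nat) (c : K) :
  (forall p, Q p != 0) ->
  (forall N, (N0 <= N)%N -> \sum_(p <- r) w p * Q p ^+ N = 0) ->
  \sum_(p <- r | Q p == c) w p = 0.
Proof.
move=> Q0 hw.
have hpoly (P : {poly K}) : \sum_(p <- r) w p * Q p ^+ N0 * P.[Q p] = 0.
  transitivity (\sum_(i < size P) P`_i * \sum_(p <- r) w p * Q p ^+ (N0 + i)).
    under eq_bigr do rewrite horner_coef mulr_sumr.
    rewrite exchange_big /=; apply: eq_bigr => i _; rewrite mulr_sumr.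
    by apply: eq_bigr => p _; rewrite exprD mulrA mulrCA mulrA.
  by rewrite big1 // => i _; rewrite hw ?leq_addr ?mulr0.
case: (eqVneq c 0) => [->|c0].
  by rewrite big1 // => p; rewrite (negbTE (Q0 p)).
pose roots := [seq d <- [seq Q p | p <- r] | d != c].
pose P := \prod_(d <- roots) ('X - d%:P).
have Pc : P.[c] != 0.
  by rewrite -[_ == 0]/(root P c) root_prod_XsubC mem_filter eqxx.
have := hpoly P.
have rootsP p : Q p \in [seq Q p | p <- r] -> Q p != c -> P.[Q p] = 0.
  by move=> pr pc; apply/eqP; rewrite -[_ == 0]/(root P _) root_prod_XsubC mem_filter pc.
have key (r' : seq J) : {subset [seq Q p | p <- r'] <= [seq Q p | p <- r]} ->
    \sum_(p <- r') w p * Q p ^+ N0 * P.[Q p]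
    = (\sum_(p <- r' | Q p == c) w p) * (c ^+ N0 * P.[c]).
  elim: r' => [|p r' IH] sub; first by rewrite !big_nil mul0r.
  rewrite !big_cons IH; last by move=> d dr; apply: sub; rewrite inE dr orbT.
  case: eqP => [->|/eqP pc]; first by rewrite mulrDl !mulrA.
  by rewrite rootsP ?mulr0 ?add0r //; apply: sub; rewrite inE eqxx.
rewrite key // => /eqP; rewrite mulf_eq0 mulf_eq0 expf_eq0 (negbTE c0) andbF.
by rewrite (negbTE Pc) !orbF => /eqP.
Qed.

(** The integers from 0 to [size P] - 1 are too many to be all roots. *)
Lemma poly_int_nonroot (P : {poly int}) : P != 0 -> exists t : int, P.[t] != 0.
Proof.
move=> P0; apply: contrapT => H.
have [] := negP (negbT (ltnn (size P))).
have -> : (size P < size P)%N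
  = (size [seq i%:Z | i <- iota 0 (size P)] < size P)%N by rewrite size_map size_iota.
apply: max_poly_roots => //.
- apply/allP => t _; apply/eqP; apply: contrapT => /eqP nt.
  by apply: H; exists t.
- by rewrite map_inj_uniq ?iota_uniq // => i j [].
Qed.

(** * Additive functionals separating finitely many lattice points *)

Section Lattice.
Variable n : nat.
Local Notation Zn := {ffun 'I_n -> int}.

(* A substitution [X := t] turns the polynomials coding the vectors into integers,
   keeping finitely many of them distinct. *)
Lemma separating_functional (S : seq (Zn * Zn)) :
  exists2 phi : Zn * Zn -> int, {morph phi : a b / a + b} &
    {in S &, injective phi}.
Proof.
(* The first vector fills the coefficients below [n], the second those from [n] on; the default 0 is
   never reached. *)
pose pol (g : Zn * Zn) : {poly int} :=
  \poly_(i < n) (oapp g.1 0 (insub i)) + 'X^n * \poly_(i < n) (oapp g.2 0 (insub i)).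
have half (u v : Zn) : \poly_(i < n) (oapp u 0 (insub i)) = 
    \poly_(i < n) (oapp v 0 (insub i)) :> {poly int} -> u = v.
  move=> e; apply/ffunP => i; have := congr1 (fun P : {poly int} => P`_i) e.
  by rewrite /= !coef_poly ltn_ord valK.
have polI : injective pol.
  move=> [a a'] [b b'] e.
  have e1 : a = b.
    apply: half; apply/polyP => i; have := congr1 (fun P : {poly int} => P`_i) e.
    rewrite /= !coefD !coefXnM !coef_poly; case: ltnP => //= _.
    by rewrite !addr0.
  rewrite e1 in e *; congr (_, _); apply: half.
  by apply: (@mulfI _ 'X^n); [rewrite -size_poly_eq0 size_polyXn|apply: addrI e].
have polD : {morph pol : a b / a + b}.
  move=> a b; rewrite /pol addrACA -mulrDr; congr (_ + _ * _).
    apply/polyP => i; rewrite coefD !coef_poly; case: ltnP => // lt_in.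
    by rewrite insubT /= ffunE.
  apply/polyP => i; rewrite coefD !coef_poly; case: ltnP => // lt_in.
  by rewrite insubT /= ffunE.
(* One nonroot of this product separates all pairs at once. *)
pose R := \prod_(a <- S) \prod_(b <- S | a != b) (pol a - pol b).
have R0 : R != 0.
  rewrite prodf_seq_neq0; apply/allP => a _ /=; rewrite prodf_seq_neq0.
  apply/allP => b _; apply/implyP => ab.
  by rewrite subr_eq0; apply: contra ab => /eqP/polI ->.
have [t Rt] := poly_int_nonroot R0.
exists (fun g => (pol g).[t]) => [a b|a b aS bS pab]; first by rewrite polD hornerD.
apply/eqP; apply: contraNT Rt => ab; rewrite horner_prod.
rewrite prodf_seq_eq0; apply/hasP; exists a => //=; rewrite horner_prod prodf_seq_eq0.
by apply/hasP; exists b; rewrite // ab /= hornerD hornerN pab subrr.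
Qed.

End Lattice.

Lemma seq_argmax (T : eqType) (phi : T -> int) (S : seq T) (a : T) : a \in S ->
  exists2 a0, a0 \in S & forall b, b \in S -> phi b <= phi a0.
Proof.
elim: S a => // c S IH a _; case: S IH => [|d S] IH.
  by exists c; rewrite ?inE // => b; rewrite inE => /eqP ->.
have [a0 a0S max0] := IH d (mem_head _ _).
case: (lerP (phi c) (phi a0)) => h.
  exists a0 => [|b]; rewrite inE ?a0S ?orbT // => /orP[/eqP-> //|]; exact: max0.
exists c => [|b]; rewrite inE ?eqxx // => /orP[/eqP-> //|bS].
exact: le_trans (max0 b bS) (ltW h).
Qed.

(** * Units of a twisted group algebra *)

Section TwistedGroupAlgebra.
Variables (K : fieldType) (C : algType K) (G : zmodType).
Hypothesis separating : forall S : seq G,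
  exists2 phi : G -> int, {morph phi : a b / a + b} & {in S &, injective phi}.
Variables (E : G -> C) (chi : G -> G -> K).
Hypothesis chi_neq0 : forall a b, chi a b != 0.
Hypothesis EM : forall a b, E a * E b = chi a b *: E (a + b).
Hypothesis E0 : E 0 = 1.
Hypothesis Efree : linfree E.

Lemma lincombM s t : lincomb E s * lincomb E t =
  lincomb E [seq (pr.1.1 * pr.2.1 * chi pr.1.2 pr.2.2, pr.1.2 + pr.2.2)
            | pr <- [seq (p, r) | p <- s, r <- t]].
Proof.
rewrite /lincomb big_map big_allpairs mulr_suml; apply: eq_bigr => p _.
rewrite mulr_sumr; apply: eq_bigr => r _ /=.
by rewrite -scalerAl -scalerAr EM !scalerA.
Qed.

Lemma spannedM u v : spanned E u -> spanned E v -> spanned E (u * v).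
Proof. by move=> [s ->] [t ->]; rewrite lincombM; eexists. Qed.

(** The functional stands in for a translation-invariant order: only the two maximal indices can add
    up to [a0 + b0], so the coefficient there is a product of nonzero scalars, whereas 1 lives in
    degree 0. *)
Lemma unit_extremal (phi : G -> int) s t a0 b0 :
  {morph phi : a b / a + b} ->
  {in supp s &, injective phi} -> {in supp t &, injective phi} ->
  lincomb E s * lincomb E t = 1 -> a0 \in supp s -> b0 \in supp t ->
  (forall a, a \in supp s -> phi a <= phi a0) ->
  (forall b, b \in supp t -> phi b <= phi b0) -> a0 + b0 = 0.
Proof.
move=> phiD injs injt uv a0S b0T maxS maxT; apply/eqP; apply: contraT => g0.
(* In the collected lists every index occurs once, so the double sum can be split at [a0] and then
   at [b0]. *)
pose S := [seq (coef s a, a) | a <- supp s]; pose T := [seq (coef t a, a) | a <- supp t].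
have uvE : lincomb E S * lincomb E T = 1.
  by rewrite -uv ![in RHS]lincombE /lincomb !big_map.
rewrite lincombM in uvE; set L := map _ _ in uvE.
have L0 : lincomb E ((-1, 0) :: L) = 0.
  by rewrite /lincomb big_cons -/(lincomb E L) uvE E0 scaleN1r addNr.
have := Efree L0 (a0 + b0); rewrite /coef big_cons eq_sym (negbTE g0).
rewrite big_map big_mkcond big_allpairs big_map /= (bigD1_seq a0) ?supp_uniq //=.
rewrite big_map /= (bigD1_seq b0) ?supp_uniq //= eqxx.
have unique a b : a \in supp s -> b \in supp t -> a + b = a0 + b0 -> a = a0 /\ b = b0.
  move=> aS bT /(congr1 phi); rewrite !phiD => e.
  have ea : phi a = phi a0.
    apply/eqP; rewrite eq_le maxS //= -(lerD2r (phi b)) e lerD2l; exact: maxT.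
  by split; [apply: injs|apply: injt => //; apply: (addrI (phi a)); rewrite e ea].
rewrite [X in _ + X + _]big1_seq ?addr0; last first.
  by move=> b /andP[nb bT]; case: eqP => // /(unique _ _ a0S bT)[_ eb]; rewrite eb eqxx in nb.
rewrite big1_seq ?addr0.
  move=> /eqP; rewrite !mulf_eq0 (negbTE (chi_neq0 _ _)) orbF.
  by rewrite mem_supp in a0S; rewrite mem_supp in b0T; rewrite (negbTE a0S) (negbTE b0T).
move=> a /andP[na aS]; rewrite big_map big1_seq // => b /andP[_ bT] /=.
by case: eqP => // /(unique _ _ aS bT)[ea _]; rewrite ea eqxx in na.
Qed.

(** The extremal argument for phi and for -phi shows that the maxima cancel and the minima cancel. A
    spread in the support of [u] would then force a negative spread in that of [v], so [u] has a
    single term. *)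
Lemma twisted_unit u v : spanned E u -> spanned E v -> u * v = 1 ->
  exists a c, c != 0 /\ u = c *: E a.
Proof.
move=> [s us] [t vt] uv.
have [a aS] : exists a, a \in supp s.
  case e: (supp s) => [|a r]; last by exists a; rewrite mem_head.
  by move: uv; rewrite us lincombE e big_nil mul0r => /eqP; rewrite eq_sym oner_eq0.
have [b bT] : exists b, b \in supp t.
  case e: (supp t) => [|b r]; last by exists b; rewrite mem_head.
  by move: uv; rewrite vt lincombE e big_nil mulr0 => /eqP; rewrite eq_sym oner_eq0.
have [phi phiD phiI] := separating (supp s ++ supp t).
have injs : {in supp s &, injective phi}.
  by move=> c d cs ds; apply: phiI; rewrite mem_cat ?cs ?ds.
have injt : {in supp t &, injective phi}.
  by move=> c d cs ds; apply: phiI; rewrite mem_cat ?cs ?ds orbT.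
have [a0 a0S max0] := seq_argmax phi aS; have [b0 b0T maxb0] := seq_argmax phi bT.
pose psi c := - phi c.
have psiD : {morph psi : a b / a + b} by move=> c d; rewrite /psi phiD opprD.
have injs' : {in supp s &, injective psi} by move=> c d cs ds /oppr_inj; apply: injs.
have injt' : {in supp t &, injective psi} by move=> c d cs ds /oppr_inj; apply: injt.
have [a1 a1S max1] := seq_argmax psi aS; have [b1 b1T maxb1] := seq_argmax psi bT.
rewrite us vt in uv.
have e0 := unit_extremal phiD injs injt uv a0S b0T max0 maxb0.
have e1 := unit_extremal psiD injs' injt' uv a1S b1T max1 maxb1.
have h01 : phi a0 <= phi a1.
  rewrite -(lerD2r (phi b0)) -phiD e0 -e1 phiD lerD2l; have := maxb1 _ b0T.
  by rewrite lerN2.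
have all_a0 c : c \in supp s -> c = a0.
  move=> cS; apply: injs => //; apply/eqP; rewrite eq_le max0 //=.
  by apply: le_trans h01 _; have := max1 _ cS; rewrite lerN2.
exists a0, (coef s a0); split; first by rewrite -mem_supp.
rewrite us lincombE (bigD1_seq a0) ?supp_uniq //= big1_seq ?addr0 // => c.
by case/andP=> nc /all_a0 ec; rewrite ec eqxx in nc.
Qed.

End TwistedGroupAlgebra.

(** * Weighted shift operators on functions on the lattice *)

Section WeightedShift.
Variables (K : fieldType) (G : zmodType).

Lemma wshift_linear (p : G -> K) (d : G) (c : K) (F H : G -> K) (m : G) :
  p m * (c * F (m - d) + H (m - d)) = c * (p m * F (m - d)) + p m * H (m - d).
Proof. by rewrite mulrDr mulrCA. Qed.

(** The homogeneous operators of degree [d]: the delta function at t goes to a multiple of the one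
    at t + d. Those of degree 0 are the diagonal operators. *)
Definition wshift (p : G -> K) (d : G) : linop K G :=
  @Linop K G (fun F m => p m * F (m - d)) (@wshift_linear p d).

Lemma wshiftE p d F m : wshift p d F m = p m * F (m - d). Proof. by []. Qed.

Lemma eq_wshift p p' d : p =1 p' -> wshift p d = wshift p' d.
Proof. by move=> e; apply: linop_ext => F m; rewrite !wshiftE e. Qed.

Lemma wshift_inj p p' d : wshift p d = wshift p' d -> p =1 p'.
Proof.
move=> e m; have := congr1 (fun A : linop K G => A (fun=> 1) m) e.
by rewrite /= !mulr1.
Qed.

Lemma wshift_eq0 p d m : wshift p d = 0 -> p m = 0.
Proof.
by move=> /(congr1 (fun A : linop K G => A (fun=> 1) m)) /=; rewrite mulr1.
Qed.

Lemma wshiftM p d p' d' :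
  wshift p d * wshift p' d' = wshift (fun m => p m * p' (m - d)) (d + d').
Proof.
by apply: linop_ext => F m; rewrite linopME !wshiftE mulrA opprD addrA.
Qed.

Lemma wshift1 : wshift (fun=> 1) 0 = 1.
Proof. by apply: linop_ext => F m; rewrite wshiftE mul1r subr0. Qed.

Lemma wshiftD p p' d : wshift p d + wshift p' d = wshift (fun m => p m + p' m) d.
Proof. by apply: linop_ext => F m; rewrite linopDE !wshiftE mulrDl. Qed.

Lemma wshiftZ a p d : a *: wshift p d = wshift (fun m => a * p m) d.
Proof. by apply: linop_ext => F m; rewrite linopZE !wshiftE mulrA. Qed.

Lemma wshift_deg p d p' d' m :
  wshift p d = wshift p' d' -> p m != 0 -> d = d'.
Proof.
move=> e pm; apply/eqP; apply: contraT => dd.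
have := congr1 (fun A : linop K G => A (fun t => (t == m - d)%:R) m) e.
rewrite /= eqxx mulr1 (inj_eq (@addrI _ m)) eqr_opp eq_sym (negbTE dd) mulr0.
by move/eqP; rewrite (negbTE pm).
Qed.

End WeightedShift.

(** * Characters of the lattice and independence of weighted shifts *)

Section Lattice.
Variables (K : fieldType) (n : nat) (q : 'I_n -> K).
Hypothesis hq : forall i, q i != 0.
Hypothesis hindep :
  forall e : 'I_n -> int, \prod_(i < n) q i ^ e i = 1 -> forall i, e i = 0.
Local Notation Zn := {ffun 'I_n -> int}.

Definition axis (i : 'I_n) (k : int) : Zn := [ffun j => if j == i then k else 0].

Lemma axisE i k j : axis i k j = if j == i then k else 0. Proof. by rewrite ffunE. Qed.
Lemma axisxx i k : axis i k i = k. Proof. by rewrite ffunE eqxx. Qed.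
Lemma axis_neq i k j : j != i -> axis i k j = 0.
Proof. by rewrite ffunE => /negbTE ->. Qed.
Lemma axis0 i : axis i 0 = 0.
Proof. by apply/ffunP => j; rewrite !ffunE; case: ifP. Qed.
Lemma axisD i a b : axis i (a + b) = axis i a + axis i b.
Proof. by apply/ffunP => j; rewrite !ffunE; case: ifP; rewrite ?addr0. Qed.
Lemma axisN i a : axis i (- a) = - axis i a.
Proof. by apply/ffunP => j; rewrite !ffunE; case: ifP; rewrite ?oppr0. Qed.

(** The Hadamard product. *)
Definition had (a m : Zn) : Zn := [ffun i => a i * m i].
Lemma hadDl a b m : had (a + b) m = had a m + had b m.
Proof. by apply/ffunP => j; rewrite !ffunE mulrDl. Qed.
Lemma hadDr a b m : had m (a + b) = had m a + had m b.
Proof. by apply/ffunP => j; rewrite !ffunE mulrDr. Qed.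
Lemma had0l m : had 0 m = 0.
Proof. by apply/ffunP => j; rewrite !ffunE mul0r. Qed.
Lemma had0r m : had m 0 = 0.
Proof. by apply/ffunP => j; rewrite !ffunE mulr0. Qed.
Lemma hadN a m : had a (- m) = - had a m.
Proof. by apply/ffunP => j; rewrite !ffunE mulrN. Qed.
Lemma hadNl a m : had (- a) m = - had a m.
Proof. by apply/ffunP => j; rewrite !ffunE mulNr. Qed.
Lemma had_axis i k m : had (axis i k) m = axis i (k * m i).
Proof. by apply/ffunP => j; rewrite !ffunE; case: eqP => [->|]; rewrite ?mul0r. Qed.
Lemma had_axisr i k m : had m (axis i k) = axis i (m i * k).
Proof. by apply/ffunP => j; rewrite !ffunE; case: eqP => [->|]; rewrite ?mulr0. Qed.

Definition qpow (v : Zn) : K := \prod_i q i ^ v i.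
Lemma qpow_neq0 v : qpow v != 0.
Proof. by apply/prodf_neq0 => i _; rewrite expfz_neq0. Qed.
Lemma qpow0 : qpow 0 = 1.
Proof. by rewrite /qpow big1 // => i _; rewrite ffunE expr0z. Qed.
Lemma qpowD u v : qpow (u + v) = qpow u * qpow v.
Proof.
by rewrite /qpow -big_split; apply: eq_bigr => i _; rewrite ffunE expfzDr.
Qed.
Lemma qpowN u : qpow (- u) = (qpow u)^-1.
Proof.
by apply: (mulfI (qpow_neq0 u)); rewrite -qpowD subrr qpow0 mulfV ?qpow_neq0.
Qed.
Lemma qpow_axis i k : qpow (axis i k) = q i ^ k.
Proof.
rewrite /qpow (big_only1 i) ?axisxx // => j ji _.
by rewrite axis_neq ?expr0z.
Qed.
(** Every later use of the multiplicative independence passes through this form. *)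
Lemma qpow_inj : injective qpow.
Proof.
move=> u v e; apply/eqP; rewrite -subr_eq0; apply/eqP/ffunP => i; rewrite [RHS]ffunE.
by apply: (hindep (e := (u - v))); rewrite -/(qpow _) qpowD qpowN e mulfV ?qpow_neq0.
Qed.
Lemma q_exp_eq1 i (k : int) : q i ^ k = 1 -> k = 0.
Proof.
by rewrite -qpow_axis -qpow0 => /qpow_inj/ffunP/(_ i); rewrite axisxx ffunE.
Qed.
Lemma q_neq1 i : q i != 1.
Proof. by apply/eqP => e; have := @q_exp_eq1 i 1; rewrite expr1z => /(_ e). Qed.

(** The eigenvalue of z^a on the delta function at [m]; it is multiplicative in each argument. *)
Definition chr (a m : Zn) : K := qpow (had a m).
Lemma chr_neq0 a m : chr a m != 0. Proof. exact: qpow_neq0. Qed.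
Lemma chrDl a b m : chr (a + b) m = chr a m * chr b m.
Proof. by rewrite /chr hadDl qpowD. Qed.
Lemma chrDr a b m : chr m (a + b) = chr m a * chr m b.
Proof. by rewrite /chr hadDr qpowD. Qed.
Lemma chr0l m : chr 0 m = 1. Proof. by rewrite /chr had0l qpow0. Qed.
Lemma chr0r m : chr m 0 = 1. Proof. by rewrite /chr had0r qpow0. Qed.
Lemma chrN a m : chr a (- m) = (chr a m)^-1.
Proof. by rewrite /chr hadN qpowN. Qed.
Lemma chrNl a m : chr (- a) m = (chr a m)^-1.
Proof. by rewrite /chr hadNl qpowN. Qed.
Lemma chr_axis i k m : chr (axis i k) m = q i ^ (k * m i).
Proof. by rewrite /chr had_axis qpow_axis. Qed.

Definition diagonal (N : nat) : Zn := [ffun=> N%:Z].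

Lemma chr_diagonal a N : chr a (diagonal N) = qpow a ^+ N.
Proof.
rewrite /chr /qpow -prodrXl; apply: eq_bigr => i _; rewrite !ffunE.
by rewrite exprnP exprz_exp.
Qed.

(** Weights such as q_i^(m_i + 1) - 1 vanish on a hyperplane, so nowhere vanishing is too much to
    ask. This weaker property is stable under the products occurring in compositions of shifts and
    still holds far out on the diagonal. *)
Definition eventually_neq0 (p : Zn -> K) : Prop :=
  exists N : nat, forall m : Zn, (forall j, N%:Z <= m j) -> p m != 0.

Lemma eventually_neq0_nowhere0 p : (forall m, p m != 0) -> eventually_neq0 p.
Proof. by exists 0%N. Qed.

Lemma eventually_neq0M p p' (d : Zn) : eventually_neq0 p -> eventually_neq0 p' ->
  eventually_neq0 (fun m => p m * p' (m - d)).
Proof.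
move=> [N hN] [N' hN']; exists (N + N' + \sum_j `|d j|)%N => m hm.
apply: mulf_neq0; [apply: hN|apply: hN'] => j; have := hm j; first by lia.
have : (`|d j| <= \sum_j `|d j|)%N by rewrite (bigD1 j) //= leq_addr.
rewrite !ffunE; move: (\sum_j _)%N (d j : int) (m j : int) => D a b.
by lia.
Qed.

(* Testing on the indicator of [m - eps d] at [m] selects the degree [d]; letting [m]
   run along the diagonal leaves a power sum in the numbers [qpow (eps a)]. *)
Lemma wshift_free (eps : Zn) (b : Zn * Zn -> linop K Zn) :
  (forall i, eps i != 0) ->
  (forall d, exists g, eventually_neq0 g /\ forall a, exists k, k != 0 /\
     b (a, d) = wshift (fun m => k * chr (had eps a) m * g m) (had eps d)) ->
  linfree b.
Proof.
move=> eps0 /choice[g hg] s s0 [a0 d0].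
have hadI : injective (had eps).
  move=> u v /ffunP e; apply/ffunP => i; have := e i; rewrite !ffunE.
  exact: mulfI.
have gneq0 d : eventually_neq0 (g d) by case: (hg d).
have /choice[k hk] : forall i, exists k, k != 0 /\
    b i = wshift (fun m => k * chr (had eps i.1) m * g i.2 m) (had eps i.2).
  by move=> [a d]; case: (hg d) => _; apply.
have [N0 hN0] := gneq0 d0.
pose w (p : K * (Zn * Zn)) := p.1 * k p.2 * (p.2.2 == d0)%:R.
pose Q (p : K * (Zn * Zn)) := qpow (had eps p.2.1).
have sums N : (N0 <= N)%N -> \sum_(p <- s) w p * Q p ^+ N = 0.
  move=> leN; pose m := diagonal N.
  have gm : g d0 m != 0 by apply: hN0 => j; rewrite ffunE lez_nat.
  apply: (mulIf gm); rewrite mul0r mulr_suml.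
  have := congr1 (fun A : linop K Zn => A (fun t => (t == m - had eps d0)%:R) m) s0.
  rewrite /lincomb linop_sumE => e; apply: (etrans _ e); apply: eq_bigr => p _.
  have [_ ->] := hk p.2; rewrite linopZE wshiftE (inj_eq (@addrI _ m)) eqr_opp.
  rewrite (inj_eq hadI) /w -chr_diagonal -/m; case: eqP => [->|_]; rewrite ?mulr1 ?mulr0 ?mul0r //.
  by rewrite !mulrA.
have := power_sum_coef0 (qpow (had eps a0)) (fun p => qpow_neq0 _) sums.
have [k0 _] := hk (a0, d0); move=> e; apply: (mulIf k0); rewrite mul0r -e.
rewrite /coef mulr_suml [LHS]big_mkcond [RHS]big_mkcond; apply: eq_bigr => p _ /=.
rewrite /w /Q (inj_eq qpow_inj) (inj_eq hadI); case: p => c [a d] /=.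
rewrite xpair_eqE; case: eqP => [->|] //=.
by case: eqP => [->|_]; rewrite ?mulr1 ?mulr0.
Qed.

End Lattice.

(** * The representation of the localized algebra by weighted shifts *)

Section Representation.
Variables (K : fieldType) (n : nat) (q : 'I_n -> K) (lam : 'I_n -> 'I_n -> K).
Hypothesis hq : forall i, q i != 0.
Hypothesis hlam0 : forall i j, lam i j != 0.
Hypothesis hlaminv : forall i j, lam i j = (lam j i)^-1.
Hypothesis hindep :
  forall e : 'I_n -> int, \prod_(i < n) q i ^ e i = 1 -> forall i, e i = 0.
Local Notation Zn := {ffun 'I_n -> int}.
Local Notation chr := (chr q).

Let q1_neq0 i : q i - 1 != 0. Proof. by rewrite subr_eq0 (q_neq1 hq hindep). Qed.

(** The weight of y_i. Only coordinates j < i enter, so of two shifts in different directions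
    exactly one picks up a scalar from the other, and this scalar is the commutation factor. *)
Definition tau (i : 'I_n) (m : Zn) : K := \prod_(j < n | (j < i)%N) lam i j ^ m j.

Lemma tau_neq0 i m : tau i m != 0.
Proof. by apply/prodf_neq0 => j _; rewrite expfz_neq0. Qed.

Lemma tau0 i : tau i 0 = 1.
Proof. by rewrite /tau big1 // => j _; rewrite ffunE expr0z. Qed.

Lemma tauD i m m' : tau i (m + m') = tau i m * tau i m'.
Proof.
by rewrite /tau -big_split; apply: eq_bigr => j _; rewrite ffunE expfzDr.
Qed.

Lemma tauN i m : tau i (- m) = (tau i m)^-1.
Proof.
by apply: (mulfI (tau_neq0 i m)); rewrite -tauD subrr tau0 mulfV ?tau_neq0.
Qed.

Lemma tau_axis i j k : tau i (axis j k) = if (j < i)%N then lam i j ^ k else 1.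
Proof.
rewrite /tau; case: ifP => ji; last first.
  rewrite big1 // => l li; rewrite axisE; case: eqP => [lj|]; last by rewrite expr0z.
  by rewrite lj ji in li.
rewrite (big_only1 j) ?axisxx // => l lj _.
by rewrite axis_neq ?expr0z.
Qed.

(** A bicharacter: the weight of y^d up to a scalar that depends on the order of the factors. *)
Definition twist (d m : Zn) : K := \prod_i tau i m ^ d i.

Lemma twist_neq0 d m : twist d m != 0.
Proof. by apply/prodf_neq0 => j _; rewrite expfz_neq0 ?tau_neq0. Qed.

Lemma twistDl d d' m : twist (d + d') m = twist d m * twist d' m.
Proof.
by rewrite /twist -big_split; apply: eq_bigr => i _; rewrite ffunE expfzDr ?tau_neq0.
Qed.

Lemma twistDr d m m' : twist d (m + m') = twist d m * twist d m'.
Proof.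
rewrite /twist -big_split; apply: eq_bigr => i _; rewrite tauD.
by rewrite exprzMl ?unitfE ?tau_neq0.
Qed.

Lemma twist0 m : twist 0 m = 1.
Proof. by rewrite /twist big1 // => i _; rewrite ffunE expr0z. Qed.

Lemma twist_axis i k m : twist (axis i k) m = tau i m ^ k.
Proof.
rewrite /twist (big_only1 i) ?axisxx // => j ji _.
by rewrite axis_neq ?expr0z.
Qed.

(* [torus (a, d)] is the monomial [z^a y^d] of the quantum torus obtained by
   inverting the [y_i]. *)
Definition torus (a : Zn * Zn) : linop K Zn :=
  wshift (fun m => chr a.1 m * twist a.2 m) a.2.

Lemma torusM a b :
  torus a * torus b = (chr b.1 (- a.2) * twist b.2 (- a.2)) *: torus (a + b).
Proof.
rewrite /torus wshiftM wshiftZ; apply: eq_wshift => m.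
by rewrite chrDl // twistDl chrDr // twistDr; ring.
Qed.

Lemma torus0 : torus 0 = 1.
Proof. by rewrite -wshift1; apply: eq_wshift => m; rewrite chr0l twist0 mulr1. Qed.

Lemma torus_free : linfree torus.
Proof.
pose one : Zn := [ffun=> 1]; have had1 v : had one v = v.
  by apply/ffunP => i; rewrite !ffunE mul1r.
apply: (wshift_free hq hindep (eps := one)) => [i|d]; first by rewrite ffunE.
exists (twist d); split=> [|a].
  by apply: eventually_neq0_nowhere0 => m; apply: twist_neq0.
exists 1; split; first exact: oner_neq0.
by rewrite !had1; apply: eq_wshift => m; rewrite mul1r.
Qed.

Lemma torus_spannedM u v : spanned torus u -> spanned torus v -> spanned torus (u * v).
Proof. exact: (spannedM torusM). Qed.

Lemma torus_unit u v : spanned torus u -> spanned torus v -> u * v = 1 ->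
  exists a c, c != 0 /\ u = c *: torus a.
Proof.
apply: (twisted_unit (@separating_functional n) _ torusM torus0 torus_free) => a b.
by rewrite mulf_neq0 ?twist_neq0 ?chr_neq0.
Qed.

Definition repY (i : 'I_n) : linop K Zn := wshift (tau i) (axis i 1).
(** A q-derivative: the delta function at t goes to a multiple of the one at t - e_i, with the
    q-number of t_i as a factor. The identity [m + 1] - q [m] = 1 for q-numbers gives the relation
    x_i y_i - q_i y_i x_i = 1. *)
Definition repX (i : 'I_n) : linop K Zn :=
  wshift (fun m : Zn => (tau i m)^-1 * ((q i ^ (m i + 1) - 1) / (q i - 1))) (axis i (-1)).
Definition repZ (i : 'I_n) (k : int) : linop K Zn := wshift (fun m : Zn => q i ^ (k * m i)) 0.

Lemma repXY i : repX i * repY i = wshift (fun m : Zn => (q i ^ (m i + 1) - 1) / (q i - 1)) 0.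
Proof.
rewrite /repX /repY wshiftM -axisD addNr axis0; apply: eq_wshift => m.
by rewrite tauD tauN tau_axis ltnn invr1 mulr1 mulrAC mulVf ?tau_neq0 // mul1r.
Qed.

Lemma repYX i : repY i * repX i = wshift (fun m : Zn => (q i ^ m i - 1) / (q i - 1)) 0.
Proof.
rewrite /repX /repY wshiftM -axisD subrr axis0; apply: eq_wshift => m.
rewrite tauD tauN tau_axis ltnn invr1 mulr1 !ffunE eqxx subrK; field.
by rewrite q1_neq0 tau_neq0.
Qed.

Lemma rep_rel : qweyl_rel q lam repX repY.
Proof.
split=> [i j ij|i]; last first.
  rewrite repXY repYX -scaleNr wshiftZ wshiftD -wshift1; apply: eq_wshift => m.
  rewrite expfzDr // expr1z; field; exact: q1_neq0.
have ji : (j < i)%N = false by rewrite ltnNge ltnW.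
have nij : j != i by apply/eqP => e; rewrite e ltnn in ij.
have nji : i != j by rewrite eq_sym.
have lij : lam i j = (lam j i)^-1 by exact: hlaminv.
have e1 (k : int) (m : Zn) : (m - axis i k) j = m j.
  by rewrite !ffunE (negbTE nij) subr0.
have e2 (k : int) (m : Zn) : (m - axis j k) i = m i.
  by rewrite !ffunE (negbTE nji) subr0.
have t1 (k : int) (m : Zn) : tau j (m - axis i k) = tau j m / lam j i ^ k.
  by rewrite tauD tauN tau_axis ij.
have t2 (k : int) (m : Zn) : tau i (m - axis j k) = tau i m.
  by rewrite tauD tauN tau_axis ji invr1 mulr1.
have l0 := hlam0 j i.
split; rewrite /repX /repY !wshiftM wshiftZ [X in _ = wshift _ X]addrC; apply: eq_wshift => m;
  rewrite ?e1 ?e2 ?t1 ?t2 ?lij ?expr1z ?exprN1; field; rewrite ?q1_neq0 ?tau_neq0 ?l0 ?oner_neq0 //.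
Qed.

Lemma repZ_add i k l : repZ i k * repZ i l = repZ i (k + l).
Proof.
rewrite /repZ wshiftM addr0; apply: eq_wshift => m.
by rewrite subr0 mulrDl expfzDr.
Qed.

Lemma repZ0 i : repZ i 0 = 1.
Proof. by rewrite -wshift1; apply: eq_wshift => m; rewrite mul0r expr0z. Qed.

Lemma rep_zgen i : zgen repX repY i = repZ i 1.
Proof.
rewrite /zgen repXY repYX -scaleN1r wshiftZ wshiftD; apply: eq_wshift => m.
by rewrite mul1r expfzDr // expr1z; field; apply: q1_neq0.
Qed.

Lemma rep_zgen_inv i : invertible (zgen repX repY i).
Proof.
by exists (repZ i (-1)); rewrite rep_zgen !repZ_add subrr addNr repZ0.
Qed.

Lemma repY_spanned i : spanned torus (repY i).
Proof.
suff -> : repY i = torus (0, axis i 1) by apply: spanned_basis.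
by apply: eq_wshift => m; rewrite chr0l twist_axis mul1r expr1z.
Qed.

Lemma repZ_torus i k : repZ i k = torus (axis i k, 0).
Proof. by apply: eq_wshift => m; rewrite twist0 chr_axis mulr1. Qed.

(** Once y_i is invertible, x_i y_i = (q_i z_i - 1) / (q_i - 1) can be solved for x_i. *)
Lemma repX_spanned i : spanned torus (repX i).
Proof.
suff -> : repX i = (q i - 1)^-1 *: (q i *: torus (axis i 1, axis i (-1))
                                    - torus (0, axis i (-1))).
  by apply: spannedZ; apply: spannedB; first apply: spannedZ; apply: spanned_basis.
rewrite -scaleN1r !wshiftZ wshiftD wshiftZ; apply: eq_wshift => m /=.
rewrite !twist_axis chr0l chr_axis mul1r exprN1 expfzDr // expr1z; field.
by rewrite tau_neq0 q1_neq0.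
Qed.

(** * Functions supported on the nonnegative orthant, and units *)

Definition nonneg_supported (F : Zn -> K) : Prop :=
  forall (m : Zn) j, m j < 0 -> F m = 0.
Definition preserves_nonneg (A : linop K Zn) : Prop :=
  forall F, nonneg_supported F -> nonneg_supported (A F).

Lemma repY_nonneg i : preserves_nonneg (repY i).
Proof.
move=> F hF m j mj; rewrite wshiftE (hF _ j) ?mulr0 // !ffunE.
by move: (m j : int) mj => t; case: eqP; lia.
Qed.

Lemma repX_nonneg i : preserves_nonneg (repX i).
Proof.
(* At m_i = -1 the shift reads a value inside the orthant, but the q-number of 0 annihilates it. *)
move=> F hF m j mj; rewrite wshiftE; case: (eqVneq (m i) (-1)) => [->|mi].
  by rewrite addNr expr0z subrr !(mul0r, mulr0).
rewrite (hF _ j) ?mulr0 // !ffunE; case: eqP => [ji|_]; last by rewrite subr0.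
by move: mi mj; rewrite ji; move: (m i : int) => t; lia.
Qed.

Lemma repZ_nonneg i k : preserves_nonneg (repZ i k).
Proof. by move=> F hF m j mj; rewrite wshiftE (hF _ j) ?mulr0 // subr0. Qed.

Lemma preserves_nonneg_lin (a : K) A D : preserves_nonneg A -> preserves_nonneg D ->
  preserves_nonneg (a *: A + D).
Proof.
by move=> hA hD F hF m j mj; rewrite linopDE linopZE (hA F hF m j) ?(hD F hF m j) // mulr0 addr0.
Qed.

(** The delta function at 0 is sent to a nonzero multiple of the one at [a.2]. *)
Lemma torus_nonneg_deg a c : c != 0 -> preserves_nonneg (c *: torus a) ->
  forall j, 0 <= a.2 j.
Proof.
move=> c0 h j; rewrite leNgt; apply/negP => aj.
have h0 : nonneg_supported (fun t : Zn => (t == 0)%:R).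
  by move=> m i mi; case: eqP => // e; move: mi; rewrite e ffunE.
have /eqP := h _ h0 _ _ aj.
by rewrite linopZE wshiftE subrr eqxx mulr1 !mulf_eq0 (negbTE c0) (negbTE (twist_neq0 _ _))
           (negbTE (chr_neq0 hq _ _)).
Qed.

Lemma torus_nonneg_unit u v : spanned torus u -> spanned torus v -> u * v = 1 ->
  v * u = 1 -> preserves_nonneg u -> preserves_nonneg v ->
  exists a c, c != 0 /\ u = wshift (fun m => c * chr a m) 0.
Proof.
move=> su sv uv vu hu hv.
have [a [c [c0 ua]]] := torus_unit su sv uv; have [b [d [d0 vb]]] := torus_unit sv su vu.
have a0 := torus_nonneg_deg c0 (eq_ind _ preserves_nonneg hu _ ua).
have b0 := torus_nonneg_deg d0 (eq_ind _ preserves_nonneg hv _ vb).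
have ab : a.2 + b.2 = 0.
  move: uv; rewrite ua vb -scalerAl -scalerAr torusM !scalerA -wshift1 wshiftZ.
  move=> /(wshift_deg (m := 0)); apply.
  by rewrite !mulf_neq0 ?chr_neq0 ?twist_neq0.
have a20 : a.2 = 0.
  apply/ffunP => j; rewrite ffunE; have := congr1 (fun f : Zn => f j) ab.
  rewrite !ffunE; have := a0 j; have := b0 j.
  by move: (a.2 j : int) (b.2 j : int) => s t; lia.
exists a.1, c; split => //; rewrite ua /torus a20 wshiftZ; apply: eq_wshift => m.
by rewrite twist0 mulr1.
Qed.

(** The monomial given by [torus_unit] has degree 0, since a diagonal operator with a nonzero weight
    at 0 is not a proper shift. *)
Lemma torus_diag_unit p p' : spanned torus (wshift p 0) -> spanned torus (wshift p' 0) ->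
  (forall m, p m * p' m = 1) ->
  exists a c, c != 0 /\ (forall m, p m = c * chr a m).
Proof.
move=> sp sp' pp.
have uv : wshift p 0 * wshift p' 0 = 1.
  by rewrite wshiftM addr0 -wshift1; apply: eq_wshift => m; rewrite subr0.
have [a [c [c0 e]]] := torus_unit sp sp' uv.
have a20 : a.2 = 0.
  symmetry; move: e; rewrite wshiftZ => /(wshift_deg (m := 0)); apply.
  by apply/eqP => p0; have /eqP := pp 0; rewrite p0 mul0r eq_sym oner_eq0.
exists a.1, c; split=> // m; move: e; rewrite /torus a20 wshiftZ => /wshift_inj ->.
by rewrite twist0 mulr1.
Qed.

End Representation.

(** * A spanning set of monomials *)

Section IntegerPowers.
Variables (R : pzRingType) (u v : R).

(* [u ^ k] for [k >= 0] and [v ^ |k|] for [k < 0]: an integer power of [u] when [v] is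
   its inverse, but also the [y_i]-or-[x_i] part of a normal monomial. *)
Definition ipow (k : int) : R :=
  match k with Posz m => u ^+ m | Negz m => v ^+ m.+1 end.

Lemma ipow0 : ipow 0 = 1. Proof. by []. Qed.
Lemma ipow1 : ipow 1 = u. Proof. by []. Qed.
Lemma ipowN1 : ipow (-1) = v. Proof. by []. Qed.

Lemma ipow_succ k : 0 <= k -> u * ipow k = ipow (k + 1).
Proof. by case: k => // m _; rewrite -exprS -[1]/(1%:Z) -PoszD addn1. Qed.

Lemma ipow_pred k : k <= 0 -> v * ipow k = ipow (k - 1).
Proof.
case: k => [[|m]|m] // _; first by rewrite mulr1.
by have -> : Negz m - 1 = Negz m.+1 by lia.
Qed.

Hypotheses (uv : u * v = 1) (vu : v * u = 1).

Lemma ipowS k : u * ipow k = ipow (k + 1).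
Proof.
case: (lerP 0 k) => h; first exact: ipow_succ.
by rewrite -[k in LHS](addrK 1) -ipow_pred ?mulrA ?uv ?mul1r //; lia.
Qed.

Lemma ipowP k : v * ipow k = ipow (k - 1).
Proof.
case: (lerP k 0) => h; first exact: ipow_pred.
by rewrite -[k in LHS](subrK 1) -ipow_succ ?mulrA ?vu ?mul1r //; lia.
Qed.

Lemma ipowSr k : ipow k * u = ipow (k + 1).
Proof.
rewrite -ipowS; case: k => m /=; first by rewrite -exprSr -exprS.
by rewrite {1}exprSr -mulrA vu mulr1 exprS mulrA uv mul1r.
Qed.

End IntegerPowers.

(** * Commutation up to a scalar *)

Section QCommutation.
Variables (K : fieldType) (B : algType K).

(** The scalar stays anonymous because spanning is insensitive to it. *)
Definition qcomm (g h : B) : Prop := exists c : K, c != 0 /\ g * h = c *: (h * g).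

Lemma qcomm1 g : qcomm g 1.
Proof. by exists 1; rewrite oner_neq0 scale1r mulr1 mul1r. Qed.

Lemma qcommM g h k : qcomm g h -> qcomm g k -> qcomm g (h * k).
Proof.
move=> [c [c0 ec]] [d [d0 ed]]; exists (c * d); split; first exact: mulf_neq0.
by rewrite mulrA ec -scalerAl -(mulrA h g) ed -scalerAr scalerA mulrA.
Qed.

Lemma qcommX g h k : qcomm g h -> qcomm g (h ^+ k).
Proof.
move=> gh; elim: k => [|k IH]; first by rewrite expr0; apply: qcomm1.
by rewrite exprS; apply: qcommM.
Qed.

Lemma qcomm_ipow g u v k : qcomm g u -> qcomm g v -> qcomm g (ipow u v k).
Proof. by move=> gu gv; case: k => m; apply: qcommX. Qed.

Lemma qcomm_comm g h : GRing.comm g h -> qcomm g h.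
Proof. by move=> e; exists 1; rewrite oner_neq0 scale1r. Qed.

Lemma qcomm_inv g h hi : h * hi = 1 -> hi * h = 1 -> qcomm g h -> qcomm g hi.
Proof.
move=> hhi hih [c [c0 e]]; exists c^-1; split; first by rewrite invr_eq0.
have e' : h * g = c^-1 *: (g * h) by rewrite e scalerA mulVf ?scale1r.
rewrite -[LHS]mul1r -hih -mulrA (mulrA h g) e' -scalerAl -scalerAr.
by rewrite -(mulrA g) hhi mulr1.
Qed.

Lemma qcomm_sym g h : qcomm g h -> qcomm h g.
Proof.
move=> [c [c0 e]]; exists c^-1; split; first by rewrite invr_eq0.
by rewrite e scalerA mulVf ?scale1r.
Qed.

(** The factor [g] travels to slot [i] at the cost of one scalar [c] and is absorbed there; the
    other slots are untouched. *)
Lemma prod_slot (n : nat) (J : Type) (s : seq 'I_n) (i : 'I_n) (g : B) (h : 'I_n -> B)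
    (l : seq (K * J)) (h' : J -> B) :
  uniq s -> i \in s -> (forall j, j != i -> qcomm g (h j)) ->
  g * h i = \sum_(p <- l) p.1 *: h' p.2 ->
  exists c : K, g * \prod_(j <- s) h j =
    c *: \sum_(p <- l) p.1 *: \prod_(j <- s) (if j == i then h' p.2 else h j).
Proof.
move=> us si gh gi; elim: s us si => // k s IH /= /andP[ks us]; rewrite inE.
case: (eqVneq i k) => [ik _|ik /= si].
  exists 1; rewrite scale1r big_cons -ik mulrA gi mulr_suml; apply: eq_bigr => p _.
  rewrite big_cons eqxx -scalerAl big_seq [X in _ = _ *: (_ * X)]big_seq.
  congr (_ *: (_ * _)); apply: eq_bigr => j js; case: eqP => // ji.
  by rewrite ji ik (negbTE ks) in js.
have [c hc] := IH us si; have [d [_ hd]] : qcomm g (h k) by apply: gh; rewrite eq_sym.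
exists (d * c); rewrite big_cons mulrA hd -scalerAl -mulrA hc -scalerAr scalerA.
congr (_ *: _); rewrite mulr_sumr; apply: eq_bigr => p _.
by rewrite big_cons eq_sym (negbTE ik) -scalerAr.
Qed.

End QCommutation.

(** * Rewriting into normal monomials *)

Section Monomials.
Variables (K : fieldType) (n : nat) (q : 'I_n -> K) (lam : 'I_n -> 'I_n -> K).
Hypothesis hq : forall i, q i != 0.
Hypothesis hlam0 : forall i j, lam i j != 0.
Hypothesis hlaminv : forall i j, lam i j = (lam j i)^-1.
Hypothesis q_neq1 : forall i, q i != 1.
Variables (B : algType K) (x y zi : 'I_n -> B).
Hypothesis rel : qweyl_rel q lam x y.
Local Notation z := (zgen x y).
Hypothesis zzi : forall i, z i * zi i = 1.
Hypothesis ziz : forall i, zi i * z i = 1.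
Local Notation Zn := {ffun 'I_n -> int}.

(** The presentation orders the indices; since [lam i j] and [lam j i] are inverse, this relation
    and the next three have the same shape for all distinct indices. *)
Lemma qweyl_xx i j : i != j -> x i * x j = lam i j *: (x j * x i).
Proof.
case: rel => r _; case: (ltngtP i j) => [ij|ji|/val_inj ->]; last by rewrite eqxx.
  by case: (r i j ij).
by case: (r j i ji) => -> _ _ _; rewrite scalerA hlaminv mulVf ?scale1r.
Qed.

Lemma qweyl_yy i j : i != j -> y i * y j = lam i j *: (y j * y i).
Proof.
case: rel => r _; case: (ltngtP i j) => [ij|ji|/val_inj ->]; last by rewrite eqxx.
  by case: (r i j ij) => _ -> _ _; rewrite scalerA hlaminv mulVf ?scale1r.
by case: (r j i ji).
Qed.

Lemma qweyl_xy i j : i != j -> x i * y j = lam j i *: (y j * x i).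
Proof.
by case: rel => r _; case: (ltngtP i j) => [/r[]|/r[]|/val_inj ->] //; rewrite eqxx.
Qed.

Lemma qweyl_yx i j : i != j -> y i * x j = lam j i *: (x j * y i).
Proof.
move=> ij; rewrite qweyl_xy 1?eq_sym // scalerA [lam j i]hlaminv mulVf ?scale1r //.
Qed.

Lemma qweyl_zE i : z i = 1 + (q i - 1) *: (y i * x i).
Proof.
case: rel => _ /(_ i) e; rewrite /zgen -[X in X + _ *: _]e scalerBl scale1r.
by rewrite addrA subrK.
Qed.

(** Both products of x_i and y_i are affine in z_i, which lets opposite letters cancel in a normal
    monomial. *)
Lemma qweyl_yxE i : y i * x i = (q i - 1)^-1 *: (z i - 1).
Proof.
by rewrite qweyl_zE [1 + _]addrC addrK scalerA mulVf ?scale1r // subr_eq0.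
Qed.

Lemma qweyl_xyE i : x i * y i = (q i - 1)^-1 *: (q i *: z i - 1).
Proof.
have -> : x i * y i = z i + y i * x i by rewrite /zgen subrK.
rewrite qweyl_yxE.
have q1 : q i - 1 != 0 by rewrite subr_eq0.
apply: (scalerI q1); rewrite scalerDr !scalerA mulfV // !scale1r scalerBl scale1r.
by rewrite addrA subrK.
Qed.

Lemma qweyl_zy i : z i * y i = q i *: (y i * z i).
Proof.
have -> : z i * y i = y i * (1 + (q i - 1) *: (x i * y i)).
  by rewrite qweyl_zE mulrDl mul1r mulrDr mulr1 -scalerAl -scalerAr mulrA.
have q1 : q i - 1 != 0 by rewrite subr_eq0.
by rewrite qweyl_xyE scalerA mulfV // scale1r addrC subrK scalerAr.
Qed.

Lemma qweyl_xz i : x i * z i = q i *: (z i * x i).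
Proof.
have -> : x i * z i = (1 + (q i - 1) *: (x i * y i)) * x i.
  by rewrite qweyl_zE mulrDl mul1r mulrDr mulr1 -scalerAl -scalerAr mulrA.
have q1 : q i - 1 != 0 by rewrite subr_eq0.
by rewrite qweyl_xyE scalerA mulfV // scale1r addrC subrK scalerAl.
Qed.

Lemma qweyl_z_comm_x i j : i != j -> GRing.comm (z i) (x j).
Proof.
move=> ij; rewrite qweyl_zE /GRing.comm mulrDl mulrDr mul1r mulr1; congr (_ + _).
rewrite -scalerAl -scalerAr; congr (_ *: _).
rewrite -mulrA qweyl_xx // -scalerAr (mulrA (y i)) qweyl_yx // -scalerAl scalerA hlaminv.
by rewrite mulVf // scale1r mulrA.
Qed.

Lemma qweyl_z_comm_y i j : i != j -> GRing.comm (z i) (y j).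
Proof.
move=> ij; rewrite qweyl_zE /GRing.comm mulrDl mulrDr mul1r mulr1; congr (_ + _).
rewrite -scalerAl -scalerAr; congr (_ *: _).
rewrite -mulrA qweyl_xy // -scalerAr (mulrA (y i)) qweyl_yy // -scalerAl scalerA hlaminv.
by rewrite mulVf // scale1r mulrA.
Qed.

Lemma qweyl_z_comm_z i j : GRing.comm (z i) (z j).
Proof.
case: (eqVneq i j) => [-> //|ij].
by apply: commrB; apply: commrM; rewrite ?qweyl_z_comm_x ?qweyl_z_comm_y //;
  [exact: qweyl_z_comm_x|exact: qweyl_z_comm_y|exact: qweyl_z_comm_y|exact: qweyl_z_comm_x].
Qed.

Definition letter (i : 'I_n) (g : B) : Prop :=
  [\/ g = x i, g = y i, g = z i | g = zi i].

Lemma letter_qcomm i j g h : i != j -> letter i g -> letter j h -> qcomm g h.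
Proof.
move=> ij; have ji : j != i by rewrite eq_sym.
have base g' : letter i g' -> qcomm g' (x j) /\ qcomm g' (y j) /\ qcomm g' (z j).
  case=> ->.
  - split; first by exists (lam i j); rewrite hlam0 qweyl_xx.
    split; first by exists (lam j i); rewrite hlam0 qweyl_xy.
    exact/qcomm_comm/commr_sym/qweyl_z_comm_x.
  - split; first by exists (lam j i); rewrite hlam0 qweyl_yx.
    split; first by exists (lam i j); rewrite hlam0 qweyl_yy.
    exact/qcomm_comm/commr_sym/qweyl_z_comm_y.
  - split; first exact/qcomm_comm/qweyl_z_comm_x.
    split; first exact/qcomm_comm/qweyl_z_comm_y.
    exact/qcomm_comm/qweyl_z_comm_z.
  - split; first exact/qcomm_sym/(qcomm_inv (zzi i) (ziz i))/qcomm_comm/commr_sym/qweyl_z_comm_x.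
    split; first exact/qcomm_sym/(qcomm_inv (zzi i) (ziz i))/qcomm_comm/commr_sym/qweyl_z_comm_y.
    exact/qcomm_sym/(qcomm_inv (zzi i) (ziz i))/qcomm_comm/qweyl_z_comm_z.
move=> /base[gx [gy gz]]; case=> -> //.
exact: (qcomm_inv (zzi j) (ziz j)).
Qed.

Definition zpow i (k : int) : B := ipow (z i) (zi i) k.
Definition wpow i (k : int) : B := ipow (y i) (x i) k.
Definition normal_factor i (ak : int * int) : B := zpow i ak.1 * wpow i ak.2.
Definition normal_monomial (ad : Zn * Zn) : B :=
  \prod_(i < n) normal_factor i (ad.1 i, ad.2 i).

(** A letter x_i or y_i moves past the power of z_i at the cost of a scalar. It then lengthens the
    power behind it, or meets the opposite letter and merges with it into an affine expression in
    z_i. *)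
Lemma letter_factor i g a k : letter i g ->
  spanned (normal_factor i) (g * normal_factor i (a, k)).
Proof.
have single a' k' : spanned (normal_factor i) (zpow i a' * wpow i k').
  exact: (spanned_basis _ (a', k')).
have yz : qcomm (y i) (z i).
  by apply: qcomm_sym; exists (q i); rewrite hq qweyl_zy.
have xz : qcomm (x i) (z i) by exists (q i); rewrite hq qweyl_xz.
have zpow_qcomm h : qcomm h (z i) -> exists c, h * zpow i a = c *: (zpow i a * h).
  move=> hz; have [|c [_ e]] := @qcomm_ipow K B h (z i) (zi i) a hz; last by exists c.
  exact: (qcomm_inv (zzi i) (ziz i)).
have pull (b : K) k' : zpow i a * ((b *: z i - 1) * wpow i k') =
    b *: (zpow i (a + 1) * wpow i k') - zpow i a * wpow i k'.
  by rewrite mulrBl mul1r mulrBr -scalerAl -scalerAr (mulrA (zpow i a)) /zpow ipowSr.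
rewrite /normal_factor /=; case=> ->.
- have [c e] := zpow_qcomm _ xz; rewrite mulrA e -scalerAl -mulrA; apply: spannedZ.
  case: (lerP k 0) => h; first by rewrite /wpow ipow_pred //; apply: single.
  have -> : wpow i k = y i * wpow i (k - 1).
    by rewrite /wpow ipow_succ ?subrK //; lia.
  rewrite [x i * _]mulrA qweyl_xyE -scalerAl -scalerAr pull; apply: spannedZ.
  by apply: spannedB; [apply: spannedZ; apply: single|apply: single].
- have [c e] := zpow_qcomm _ yz; rewrite mulrA e -scalerAl -mulrA; apply: spannedZ.
  case: (lerP 0 k) => h; first by rewrite /wpow ipow_succ //; apply: single.
  have -> : wpow i k = x i * wpow i (k + 1).
    by rewrite /wpow ipow_pred ?addrK //; lia.
  rewrite [y i * _]mulrA qweyl_yxE -{1}[z i]scale1r.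
  rewrite -scalerAl -scalerAr pull; apply: spannedZ.
  by apply: spannedB; [apply: spannedZ; apply: single|apply: single].
- by rewrite mulrA /zpow ipowS //; apply: single.
- by rewrite mulrA /zpow ipowP //; apply: single.
Qed.

Lemma letter_monomial i g ad : letter i g ->
  spanned normal_monomial (g * normal_monomial ad).
Proof.
move=> lg; case: ad => a d; have [l el] := letter_factor (a i) (d i) lg.
have gc j : j != i -> qcomm g (normal_factor j (a j, d j)).
  move=> ji; rewrite eq_sym in ji.
  by apply: qcommM; apply: qcomm_ipow; apply: (letter_qcomm ji lg);
    [apply: Or43|apply: Or44|apply: Or42|apply: Or41].
have [c ->] := prod_slot (index_enum_uniq _) (mem_index_enum i) gc el.
apply: spannedZ; apply: spanned_sum => -[k [a' k']] /=; apply: spannedZ.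
pose upd (v : Zn) (t : int) : Zn := [ffun j => if j == i then t else v j].
suff -> : \prod_(j < n) (if j == i then normal_factor i (a', k')
   else normal_factor j (a j, d j)) = normal_monomial (upd a a', upd d k').
  exact: spanned_basis.
by apply: eq_bigr => j _; rewrite /= !ffunE; case: eqP => [->|].
Qed.

Lemma normal_monomial0 : normal_monomial 0 = 1.
Proof.
rewrite /normal_monomial big1 // => i _.
by rewrite /normal_factor /= !ffunE /zpow /wpow !ipow0 mulr1.
Qed.

Hypothesis hB : is_qweyl_localization q lam x y.

(** The elements whose left multiplication preserves the span form a subalgebra, so it is enough to
    test letters; the result is then applied to 1. *)
Lemma normal_monomial_span u : spanned normal_monomial u.
Proof.
suff h : forall u v, spanned normal_monomial v -> spanned normal_monomial (u * v).
  by rewrite -[u]mulr1; apply: h; rewrite -normal_monomial0; apply: spanned_basis.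
have letP i g : letter i g ->
    forall v, spanned normal_monomial v -> spanned normal_monomial (g * v).
  move=> lg; apply: spanned_ind => [a v w|ad]; first by rewrite mulrDr scalerAr.
  exact: letter_monomial lg.
apply: (qweyl_localization_ind _ hB zzi ziz) => [|i|i|i].
- split=> [v|a v w hv hw t ht|v w hv hw t ht]; first by rewrite mul1r.
    by rewrite mulrDl -scalerAl; apply: spanned_lin; auto.
  by rewrite -mulrA; apply/hv/hw.
- by apply: (letP i); apply: Or41.
- by apply: (letP i); apply: Or42.
- by apply: (letP i); apply: Or44.
Qed.

End Monomials.

(** * Injectivity of graded representations *)

Section GradedRepresentation.
Variables (K : fieldType) (n : nat) (q : 'I_n -> K) (lam : 'I_n -> 'I_n -> K).
Hypothesis hq : forall i, q i != 0.
Hypothesis hlam0 : forall i j, lam i j != 0.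
Hypothesis hlaminv : forall i j, lam i j = (lam j i)^-1.
Hypothesis hindep :
  forall e : 'I_n -> int, \prod_(i < n) q i ^ e i = 1 -> forall i, e i = 0.
Local Notation Zn := {ffun 'I_n -> int}.
Local Notation chr := (chr q).
Variables (B : algType K) (x y zi : 'I_n -> B).
Hypothesis hB : is_qweyl_localization q lam x y.
Local Notation z := (zgen x y).
Hypothesis zzi : forall i, z i * zi i = 1.
Hypothesis ziz : forall i, zi i * z i = 1.

Let rel : qweyl_rel q lam x y. Proof. by case: hB. Qed.
Let hq1 i : q i != 1. Proof. exact: (q_neq1 hq hindep). Qed.
Let q1_neq0 i : q i - 1 != 0. Proof. by rewrite subr_eq0. Qed.

(** As q_i is not a root of unity, c q_i^(e t) = 1 has at most one integer solution t, and
    coordinates beyond it are safe. *)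
Lemma affine_power_eventually_neq0 i (c : K) (e : int) : e != 0 ->
  eventually_neq0 (fun m : Zn => c * q i ^ (e * m i) - 1).
Proof.
move=> e0; case: (pselect (exists t : int, c * q i ^ (e * t) = 1)) => [[t et]|no].
  exists (absz t).+1 => m /(_ i) hm; rewrite subr_eq0; apply/eqP => em.
  have c0 : c != 0.
    by apply/eqP => c0; move/eqP: et; rewrite c0 mul0r eq_sym oner_eq0.
  have /eqP : q i ^ (e * (m i - t)) = 1.
    rewrite mulrBr expfzDr // -invr_expz.
    have -> : q i ^ (e * m i) = q i ^ (e * t) by apply: (mulfI c0); rewrite em et.
    by rewrite mulfV // expfz_neq0.
  move=> /eqP/(q_exp_eq1 hq hindep)/eqP; rewrite mulf_eq0 (negbTE e0) /=.
  by move: (m i : int) hm => s; lia.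
exists 0%N => m _; rewrite subr_eq0; apply/eqP => em.
by apply: no; exists (m i).
Qed.

(** Two instances matter: the representation itself, with all [eps i] = 1, whose faithfulness serves
    as a basis theorem for [B]; and its composite with an endomorphism, with [eps i] = 1 or -1,
    which gives injectivity of the latter. *)
Variable psi : B -> linop K Zn.
Hypothesis hpsi : is_alg_hom psi.
Variables (eps : Zn) (cz : 'I_n -> K) (g h : 'I_n -> Zn -> K).
Hypothesis eps_neq0 : forall i, eps i != 0.
Hypothesis cz_neq0 : forall i, cz i != 0.
Hypothesis psi_z : forall i, psi (z i) = wshift (fun m => cz i * chr (axis i (eps i)) m) 0.
Hypothesis psi_y : forall i, psi (y i) = wshift (g i) (axis i (eps i)).
Hypothesis psi_x : forall i, psi (x i) = wshift (h i) (axis i (- eps i)).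

(** A zero of [g i] is a zero of the weight of the image of y_i x_i, which is affine in that of
    z_i. *)
Lemma g_eventually_neq0 i : eventually_neq0 (g i).
Proof.
have := congr1 psi (qweyl_yxE hq1 rel i).
rewrite (alg_homM hpsi) (alg_homZ hpsi) (alg_homB hpsi) (alg_hom1 hpsi) psi_y psi_x psi_z.
rewrite wshiftM -axisD subrr axis0 -wshift1 -scaleN1r wshiftZ wshiftD wshiftZ.
move=> /wshift_inj e; have [N hN] := affine_power_eventually_neq0 i (cz i) (eps_neq0 i).
exists N => m /hN; apply: contra_neq => g0; have := e m; rewrite g0 mul0r chr_axis => /eqP.
by rewrite eq_sym mulf_eq0 invr_eq0 (negbTE (q1_neq0 i)) mulN1r => /eqP.
Qed.

Lemma h_eventually_neq0 i : eventually_neq0 (h i).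
Proof.
have := congr1 psi (qweyl_xyE hq1 rel i).
rewrite (alg_homM hpsi) !(alg_homZ hpsi) (alg_homB hpsi) (alg_hom1 hpsi) (alg_homZ hpsi).
rewrite psi_y psi_x psi_z.
rewrite wshiftM -axisD addNr axis0 -wshift1 -scaleN1r !wshiftZ wshiftD wshiftZ.
move=> /wshift_inj e; have [N hN] := affine_power_eventually_neq0 i (q i * cz i) (eps_neq0 i).
exists N => m /hN; apply: contra_neq => g0; have := e m; rewrite g0 mul0r chr_axis => /eqP.
by rewrite eq_sym mulf_eq0 invr_eq0 (negbTE (q1_neq0 i)) mulN1r mulrA => /eqP.
Qed.

Lemma psi_wpow i k : exists2 p, eventually_neq0 p &
  psi (wpow x y i k) = wshift p (had eps (axis i k)).
Proof.
have step (u : B) p e (m : nat) : psi u = wshift p e -> eventually_neq0 p ->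
    exists2 p', eventually_neq0 p' & psi (u ^+ m) = wshift p' (e *+ m).
  move=> pu p0; elim: m => [|m [p' p'0 IH]].
    exists (fun=> 1); first by apply: eventually_neq0_nowhere0 => m; apply: oner_neq0.
    by rewrite expr0 (alg_hom1 hpsi) mulr0n wshift1.
  exists (fun m => p m * p' (m - e)); first exact: eventually_neq0M.
  by rewrite exprS (alg_homM hpsi) pu IH wshiftM mulrS.
have axisMn l (m : nat) : axis i l *+ m = axis i (l * m%:Z).
  elim: m => [|m IH]; first by rewrite mulr0n mulr0 axis0.
  by rewrite mulrS IH -axisD -[m.+1%:Z]/((1 + m)%N%:Z) PoszD mulrDr mulr1.
rewrite had_axisr; case: k => m /=.
  by rewrite -axisMn; apply: (step _ (g i)); rewrite ?psi_y //; apply: g_eventually_neq0.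
rewrite NegzE mulrN -mulNr -axisMn.
by apply: (step _ (h i)); rewrite ?psi_x //; apply: h_eventually_neq0.
Qed.

Lemma psi_zi i : psi (zi i) = wshift (fun m => (cz i)^-1 * chr (axis i (- eps i)) m) 0.
Proof.
set w := wshift _ _.
have zw : psi (z i) * w = 1.
  rewrite psi_z wshiftM addr0 -wshift1; apply: eq_wshift => m.
  rewrite subr0 axisN chrNl //; field.
  by rewrite cz_neq0 chr_neq0.
by rewrite -[LHS]mulr1 -zw mulrA -(alg_homM hpsi) ziz (alg_hom1 hpsi) mul1r.
Qed.

Lemma psi_zpow i a : exists2 k : K, k != 0 &
  psi (zpow x y zi i a) = wshift (fun m => k * chr (had eps (axis i a)) m) 0.
Proof.
have step (u : B) c e (m : nat) : c != 0 -> psi u = wshift (fun m => c * chr (axis i e) m) 0 ->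
    psi (u ^+ m) = wshift (fun t => c ^+ m * chr (axis i (e * m%:Z)) t) 0.
  move=> c0 pu; elim: m => [|m IH].
    rewrite expr0 (alg_hom1 hpsi) -wshift1; apply: eq_wshift => t.
    by rewrite mulr0 axis0 chr0l mulr1.
  rewrite exprS (alg_homM hpsi) pu IH wshiftM addr0; apply: eq_wshift => t.
  rewrite subr0 -[m.+1%:Z]/((1 + m)%N%:Z) PoszD mulrDr mulr1 axisD chrDl // exprS.
  by ring.
rewrite had_axisr; case: a => m /=.
  exists (cz i ^+ m); first by rewrite expf_neq0.
  exact: step.
exists ((cz i)^-1 ^+ m.+1); first by rewrite expf_neq0 ?invr_eq0.
by rewrite NegzE mulrN -mulNr; apply: step; rewrite ?invr_eq0 ?psi_zi.
Qed.

(* [u'] stands for the same monomial as [u] with its [z]-part removed. *)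
Definition graded_pair (u u' : linop K Zn) (a d : Zn) : Prop :=
  exists p k, [/\ eventually_neq0 p, k != 0, u' = wshift p (had eps d) &
    u = wshift (fun m => k * chr (had eps a) m * p m) (had eps d)].

Lemma graded_pairM u u' a d v v' b e : graded_pair u u' a d -> graded_pair v v' b e ->
  graded_pair (u * v) (u' * v') (a + b) (d + e).
Proof.
move=> [p [k [p0 k0 -> ->]]] [p' [k' [p'0 k'0 -> ->]]].
exists (fun m => p m * p' (m - had eps d)), (k * k' * chr (had eps b) (- had eps d)).
split; first exact: eventually_neq0M.
- by rewrite !mulf_neq0 ?chr_neq0.
- by rewrite wshiftM hadDr.
- rewrite wshiftM !hadDr; apply: eq_wshift => m.
  by rewrite chrDl // chrDr //; ring.
Qed.

Lemma graded_pair_factor i a k :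
  graded_pair (psi (normal_factor x y zi i (a, k))) (psi (normal_factor x y zi i (0, k)))
    (axis i a) (axis i k).
Proof.
have [p p0 pw] := psi_wpow i k; have [c c0 pz] := psi_zpow i a.
exists p, c; split=> //; rewrite /normal_factor /= ?mul1r ?(alg_homM hpsi) ?pw //.
rewrite pz wshiftM add0r; apply: eq_wshift => m.
by rewrite subr0.
Qed.

Lemma lattice_sum (a : Zn) : a = \sum_i axis i (a i).
Proof.
apply/ffunP => j; rewrite sum_ffunE (bigD1 j) //= axisxx big1 ?addr0 // => i ij.
by rewrite axis_neq // eq_sym.
Qed.

(** The weight [p] belongs to the monomial with trivial z-part, hence depends on [d] alone, as
    [wshift_free] demands. *)
Lemma graded_pair_monomial a d :
  graded_pair (psi (normal_monomial x y zi (a, d))) (psi (normal_monomial x y zi (0, d))) a d.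
Proof.
rewrite {2}[a]lattice_sum {3}[d]lattice_sum /normal_monomial !(alg_hom_prod hpsi).
move: (index_enum _) => s; elim: s => [|i s IH].
  rewrite !big_nil; exists (fun=> 1), 1; split; rewrite ?oner_neq0 ?had0r ?wshift1 //.
    by apply: eventually_neq0_nowhere0 => m; apply: oner_neq0.
  by rewrite -wshift1; apply: eq_wshift => m; rewrite chr0l !mulr1.
rewrite !big_cons; apply: graded_pairM => //=; rewrite [(0 : Zn) i]ffunE.
exact: graded_pair_factor.
Qed.

Lemma graded_hom_free : linfree (fun ad => psi (normal_monomial x y zi ad)).
Proof.
apply: (wshift_free hq hindep eps_neq0) => d.
(* Applied to the constant function 1, a weighted shift returns its weight. *)
exists (psi (normal_monomial x y zi (0, d)) (fun=> 1)); split=> [|a].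
  have [p [k [[N hN] _ -> _]]] := graded_pair_monomial 0 d.
  by exists N => m hm; rewrite wshiftE mulr1 hN.
have [p [k [_ k0 -> ->]]] := graded_pair_monomial a d.
by exists k; split=> //; apply: eq_wshift => m; rewrite wshiftE mulr1.
Qed.

Lemma graded_hom_inj : injective psi.
Proof.
move=> u v e; apply/eqP; rewrite -subr_eq0; apply/eqP.
have [s es] := normal_monomial_span hq hlam0 hlaminv hq1 rel zzi ziz hB (u - v).
rewrite es; apply: lincomb_coef0; apply: graded_hom_free.
transitivity (psi (u - v)); last by rewrite (alg_homB hpsi) e subrr.
rewrite es /lincomb (alg_hom_sum hpsi); apply: eq_bigr => p _.
by rewrite (alg_homZ hpsi).
Qed.

End GradedRepresentation.

Lemma int_mul_eq1 (a b : int) : a * b = 1 -> a = 1 \/ a = -1.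
Proof.
move=> /(congr1 absz); rewrite abszM => /eqP; rewrite muln_eq1 => /andP[/eqP a1 _].
by lia.
Qed.

(** * Endomorphisms *)

Section Endomorphism.
Variables (K : fieldType) (n : nat) (q : 'I_n -> K) (lam : 'I_n -> 'I_n -> K).
Hypothesis hq : forall i, q i != 0.
Hypothesis hlam0 : forall i j, lam i j != 0.
Hypothesis hlaminv : forall i j, lam i j = (lam j i)^-1.
Hypothesis hindep :
  forall e : 'I_n -> int, \prod_(i < n) q i ^ e i = 1 -> forall i, e i = 0.
Local Notation Zn := {ffun 'I_n -> int}.
Local Notation chr := (chr q).
Local Notation torus := (torus q lam).
Variables (B : algType K) (x y zi : 'I_n -> B).
Hypothesis hB : is_qweyl_localization q lam x y.
Local Notation z := (zgen x y).
Hypothesis zzi : forall i, z i * zi i = 1.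
Hypothesis ziz : forall i, zi i * z i = 1.
Variable rho : B -> linop K Zn.
Hypothesis hrho : is_alg_hom rho.
Hypothesis rho_x : forall i, rho (x i) = repX q lam i.
Hypothesis rho_y : forall i, rho (y i) = repY lam i.

Local Notation wpow := (wpow x y).
Local Notation zpow := (zpow x y zi).
Local Notation monomial := (normal_monomial x y zi).

Let rel : qweyl_rel q lam x y. Proof. by case: hB. Qed.
Let hq1 i : q i != 1. Proof. exact: (q_neq1 hq hindep). Qed.
Let q1_neq0 i : q i - 1 != 0. Proof. by rewrite subr_eq0. Qed.

(** Zeros of [r] prevent inverting it, but multiplying all torus monomials by an eventually nonzero
    weight keeps them independent. *)
Lemma torus_cancel r u : eventually_neq0 r -> spanned torus u ->
  wshift r 0 * u = 0 -> u = 0.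
Proof.
move=> r0 [s ->] e; apply: lincomb_coef0.
pose b a : linop K Zn := wshift r 0 * torus a.
pose one : Zn := [ffun=> 1]; have had1 v : had one v = v.
  by apply/ffunP => i; rewrite !ffunE mul1r.
suff : linfree b.
  apply; rewrite -e /lincomb mulr_sumr; apply: eq_bigr => p _.
  by rewrite -scalerAr.
apply: (wshift_free hq hindep (eps := one)) => [i|d]; first by rewrite ffunE.
exists (fun m => r m * twist lam d (m - 0)); split=> [|a].
  apply: eventually_neq0M => //; apply: eventually_neq0_nowhere0 => m.
  exact: twist_neq0.
exists 1; split; first exact: oner_neq0.
rewrite !had1 /b wshiftM add0r; apply: eq_wshift => m.
by rewrite mul1r subr0 mulrCA.
Qed.

(** Translation of a weight is conjugation by y^d, up to the scalar [twist lam (- d) (- d)]. *)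
Lemma torus_diag_shift A d : spanned torus (wshift A 0) ->
  spanned torus (wshift (fun m => A (m - d)) 0).
Proof.
move=> sA.
have : spanned torus (torus (0, d) * wshift A 0 * torus (0, - d)).
  apply: (torus_spannedM hq hlam0); last exact: spanned_basis.
  by apply: (torus_spannedM hq hlam0) => //; apply: spanned_basis.
move=> /(spannedZ (twist lam (- d) (- d))^-1).
rewrite !wshiftM wshiftZ addr0 subrr; congr (spanned _ _); apply: eq_wshift => m /=.
rewrite !chr0l !mul1r twistDr //.
have t0 := twist_neq0 hlam0 (- d) (- d).
have e : twist lam d m * twist lam (- d) m = 1 by rewrite -twistDl // subrr twist0.
transitivity ((twist lam d m * twist lam (- d) m) * A (m - d)); last by rewrite e mul1r.
by field.
Qed.

Lemma rho_z i : rho (z i) = repZ q i 1.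
Proof.
rewrite -(@rep_zgen _ _ _ lam hq hlam0 hindep).
by rewrite /zgen (alg_homB hrho) !(alg_homM hrho) rho_x rho_y.
Qed.

Lemma rho_zi i : rho (zi i) = repZ q i (-1).
Proof.
rewrite -[LHS]mulr1 -(repZ0 q i) -(subrr 1) -repZ_add // -rho_z mulrA -(alg_homM hrho).
by rewrite ziz (alg_hom1 hrho) mul1r.
Qed.

Lemma rho_spanned u : spanned torus (rho u).
Proof.
apply: (qweyl_localization_ind (P := fun u => spanned torus (rho u)) _ hB zzi ziz) => [|i|i|i].
- split=> [|a v w hv hw|v w hv hw].
  + by rewrite (alg_hom1 hrho) -(torus0 q lam); apply: spanned_basis.
  + by rewrite (alg_homD hrho) (alg_homZ hrho); apply: spanned_lin.
  + by rewrite (alg_homM hrho); apply: (torus_spannedM hq hlam0).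
- by rewrite rho_x; apply: repX_spanned.
- by rewrite rho_y; apply: repY_spanned.
- by rewrite rho_zi (@repZ_torus _ _ _ lam); apply: spanned_basis.
Qed.

Lemma rho_nonneg u : preserves_nonneg (rho u).
Proof.
apply: (qweyl_localization_ind (P := fun u => preserves_nonneg (rho u)) _ hB zzi ziz) => [|i|i|i].
- split=> [|a v w hv hw|v w hv hw].
  + by rewrite (alg_hom1 hrho).
  + by rewrite (alg_homD hrho) (alg_homZ hrho); apply: preserves_nonneg_lin.
  + by rewrite (alg_homM hrho) => F /hw/hv.
- by rewrite rho_x; apply: repX_nonneg.
- by rewrite rho_y; apply: repY_nonneg.
- by rewrite rho_zi; apply: repZ_nonneg.
Qed.

Lemma rho_unit u v : u * v = 1 -> v * u = 1 ->
  exists a c, c != 0 /\ rho u = wshift (fun m => c * chr a m) 0.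
Proof.
move=> uv vu; apply: (torus_nonneg_unit hq hlam0 hindep (v := rho v)).
- exact: rho_spanned.
- exact: rho_spanned.
- by rewrite -(alg_homM hrho) uv (alg_hom1 hrho).
- by rewrite -(alg_homM hrho) vu (alg_hom1 hrho).
- exact: rho_nonneg.
- exact: rho_nonneg.
Qed.

Let one : Zn := [ffun=> 1].
Let had1 v : had one v = v. Proof. by apply/ffunP => i; rewrite !ffunE mul1r. Qed.

Let one_neq0 i : one i != 0. Proof. by rewrite ffunE. Qed.
Let rho_psi_z i :
  rho (z i) = wshift (fun m : Zn => (1 : K) * chr (axis i (one i)) m) 0.
Proof. by rewrite rho_z; apply: eq_wshift => m; rewrite chr_axis !ffunE !mul1r. Qed.
Let rho_psi_y i : rho (y i) = wshift (tau lam i) (axis i (one i)).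
Proof. by rewrite rho_y ffunE. Qed.
Let rho_psi_x i : rho (x i) = wshift
  (fun m : Zn => (tau lam i m)^-1 * ((q i ^ (m i + 1) - 1) / (q i - 1))) (axis i (- one i)).
Proof. by rewrite rho_x ffunE. Qed.

Lemma rho_inj : injective rho.
Proof.
exact: (graded_hom_inj hq hlam0 hlaminv hindep hB zzi ziz hrho one_neq0
  (fun=> oner_neq0 K) rho_psi_z rho_psi_y rho_psi_x).
Qed.

Lemma rho_free : linfree (fun ad => rho (monomial ad)).
Proof.
exact: (graded_hom_free hq hindep hB ziz hrho one_neq0
  (fun=> oner_neq0 K) rho_psi_z rho_psi_y rho_psi_x).
Qed.

Lemma rho_wpow i k : exists p, rho (wpow i k) = wshift p (axis i k).
Proof.
have [p _ e] := psi_wpow hq hindep hB hrho one_neq0 rho_psi_z rho_psi_y rho_psi_x i k.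
by exists p; rewrite e had1.
Qed.

Lemma rho_monomial a d : exists p k, [/\ k != 0, rho (monomial (0, d)) = wshift p d &
  rho (monomial (a, d)) = wshift (fun m => k * chr a m * p m) d].
Proof.
have [p [k [_ k0 e1 e2]]] := graded_pair_monomial hq hindep hB ziz hrho one_neq0
  (fun=> oner_neq0 K) rho_psi_z rho_psi_y rho_psi_x a d.
by exists p, k; rewrite e1 e2 !had1.
Qed.

Lemma monomial_axis i k : monomial (0, axis i k) = wpow i k.
Proof.
rewrite /normal_monomial (big_only1 i) // => [|j ji _].
  by rewrite /normal_factor /= axisxx ffunE mul1r.
by rewrite /normal_factor /= axis_neq // ffunE mul1r.
Qed.

Lemma rho_monomial_deg0 a :
  exists2 k, k != 0 & rho (monomial (a, 0)) = wshift (fun m => k * chr a m) 0.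
Proof.
have [p [k [k0 e1 ->]]] := rho_monomial a 0; exists k => //.
rewrite (normal_monomial0 x y zi : monomial (0, 0) = 1) (alg_hom1 hrho) -wshift1 in e1.
by apply: eq_wshift => m; rewrite -(wshift_inj e1) mulr1.
Qed.

(** Conjugation by z^a multiplies a monomial of degree d by [chr a d]. Scaling each coefficient by
    [chr a d - t] thus gives a vanishing combination, and freeness applies. *)
Lemma weight_support s u a t : rho u = lincomb (fun ad => rho (monomial ad)) s ->
  wshift (chr a) 0 * rho u = t *: (rho u * wshift (chr a) 0) ->
  forall ad, ad \in supp s -> chr a ad.2 = t.
Proof.
move=> us zu ad; rewrite mem_supp => cad; apply/eqP; rewrite -subr_eq0.
pose s' := [seq (p.1 * (chr a p.2.2 - t), p.2) | p <- s].
suff : coef s' ad = 0.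
  suff -> : coef s' ad = coef s ad * (chr a ad.2 - t).
    by move=> /eqP; rewrite mulf_eq0 (negbTE cad).
  by rewrite /coef big_map mulr_suml; apply: eq_bigr => p /= /eqP ->.
apply: rho_free.
(* The hypothesis only shows that the combination times z^a is zero; z^a is then inverted. *)
have zinv : wshift (chr a) 0 * wshift (chr (- a)) 0 = 1.
  rewrite wshiftM addr0 -wshift1; apply: eq_wshift => m.
  by rewrite subr0 -chrDl // subrr chr0l.
suff e : lincomb (fun ad => rho (monomial ad)) s' * wshift (chr a) 0 = 0.
  by rewrite -[LHS]mulr1 -zinv mulrA e mul0r.
move/eqP: zu; rewrite -subr_eq0 us => /eqP <-.
rewrite /lincomb big_map mulr_suml mulr_sumr mulr_suml scaler_sumr -sumrB.
apply: eq_bigr => -[c [b d]] _ /=; have [p [k [_ _ ->]]] := rho_monomial b d.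
rewrite -scaleN1r !wshiftZ !wshiftM !wshiftZ addr0 add0r wshiftD; apply: eq_wshift => m.
rewrite subr0 chrDr // chrN //; field.
exact: chr_neq0.
Qed.

(** Monomials of equal degree differ only in their z-parts, which collect on the left into one
    Laurent polynomial [A]. *)
Lemma homogeneous_factor s u i e : rho u = lincomb (fun ad => rho (monomial ad)) s ->
  (forall ad, ad \in supp s -> ad.2 = axis i e) ->
  exists A, spanned torus (wshift A 0) /\ rho u = wshift A 0 * rho (wpow i e).
Proof.
rewrite lincombE => -> hs; rewrite big_seq.
pose P (v : linop K Zn) := exists A,
  spanned torus (wshift A 0) /\ v = wshift A 0 * rho (wpow i e).
apply: (@big_ind _ P) => [|v w [A [sA ->]] [D [sD ->]]|[a d] /hs /= ->].
- exists (fun=> 0); suff e0 : wshift (fun=> 0) 0 = 0 :> linop K Zn.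
    by rewrite e0 mul0r; split=> //; apply: spanned0.
  by apply: linop_ext => F m; rewrite wshiftE mul0r.
- exists (fun m => A m + D m); rewrite -wshiftD mulrDl; split=> //.
  exact: spannedD.
- have [p [k [k0 e1 ->]]] := rho_monomial a (axis i e).
  set c := coef _ _; exists (fun m => c * k * chr a m); split.
    have -> : wshift (fun m => c * k * chr a m) 0 = (c * k) *: torus (a, 0).
      by rewrite wshiftZ; apply: eq_wshift => m; rewrite twist0 mulr1.
    exact/spannedZ/spanned_basis.
  rewrite -monomial_axis e1 wshiftM wshiftZ add0r; apply: eq_wshift => m.
  by rewrite subr0 !mulrA.
Qed.

Lemma wshift_diagC p d A :
  wshift p d * wshift A 0 = wshift (fun m => A (m - d)) 0 * wshift p d :> linop K Zn.
Proof.
rewrite !wshiftM addr0 add0r; apply: eq_wshift => m.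
by rewrite subr0 mulrC.
Qed.

(** Moving [A'] past the shift of degree [d] translates it into [D], so that [r] times [A D - mu] is
    zero. Cancelling [r] leaves [A D = mu] with [mu] a unit, so both factors are units among Laurent
    polynomials. *)
Lemma cofactor_unit A A' p p' d (mu r : Zn -> K) a (k : K) : k != 0 ->
  (forall m, mu m = k * chr a m) -> eventually_neq0 r ->
  spanned torus (wshift A 0) -> spanned torus (wshift A' 0) ->
  wshift p d * wshift p' (- d) = wshift r 0 ->
  (wshift A 0 * wshift p d) * (wshift A' 0 * wshift p' (- d))
    = wshift (fun m => r m * mu m) 0 ->
  (exists b c, c != 0 /\ forall m, A m = c * chr b m) /\
  (exists b c, c != 0 /\ forall m, A' m = c * chr b m).
Proof.
move=> k0 muE r0 sA sA' pp' e.
pose D m := A' (m - d); have sD : spanned torus (wshift D 0) by exact: torus_diag_shift.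
have diagS c b : spanned torus (wshift (fun m => c * chr b m) 0).
  have -> : wshift (fun m => c * chr b m) 0 = c *: torus (b, 0).
    by rewrite wshiftZ; apply: eq_wshift => m; rewrite twist0 mulr1.
  exact/spannedZ/spanned_basis.
have diagM C C' : wshift C 0 * wshift C' 0 = wshift (fun m => C m * C' m) 0 :> linop K Zn.
  by rewrite wshiftM addr0; apply: eq_wshift => m; rewrite subr0.
have sM C C' : spanned torus (wshift C 0) -> spanned torus (wshift C' 0) ->
    spanned torus (wshift (fun m => C m * C' m) 0).
  by rewrite -diagM; apply: torus_spannedM.
have AD m : A m * D m = mu m.
  apply/eqP; rewrite -subr_eq0; apply/eqP.
  apply: (@wshift_eq0 _ _ (fun m => A m * D m - mu m) 0).
  apply: (torus_cancel r0).
    have -> : wshift (fun m => A m * D m - mu m) 0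
      = wshift (fun m => A m * D m) 0 - wshift (fun m => k * chr a m) 0.
      by rewrite -scaleN1r wshiftZ wshiftD; apply: eq_wshift => t; rewrite muE mulN1r.
    by apply: spannedB; [apply: sM|].
  rewrite diagM; transitivity (wshift (fun t => A t * D t * r t) 0
    - wshift (fun t => r t * mu t) 0 : linop K Zn).
    by rewrite -scaleN1r wshiftZ wshiftD; apply: eq_wshift => t; ring.
  rewrite -e -diagM -diagM -pp'; apply/eqP; rewrite subr_eq0; apply/eqP.
  by rewrite !mulrA -(mulrA _ (wshift p d) (wshift A' 0)) (wshift_diagC p d A') !mulrA.
have muV m : k * chr a m * (k^-1 * chr (- a) m) = 1.
  by rewrite chrNl //; field; rewrite k0 chr_neq0.
split.
  apply: (torus_diag_unit hq hlam0 hindep sA (sM _ _ sD (diagS k^-1 (- a)))) => m.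
  by rewrite mulrA AD muE muV.
have [b [c [c0 DE]]] := torus_diag_unit hq hlam0 hindep sD (sM _ _ sA (diagS k^-1 (- a)))
  (fun m => etrans (mulrA _ _ _) (etrans (congr1 (fun t => t * _)
     (etrans (mulrC _ _) (etrans (AD m) (muE m)))) (muV m))).
(* Translating [D] back by [d] changes its character only by the scalar [chr b d]. *)
exists b, (c * chr b d); split; first by rewrite mulf_neq0 ?chr_neq0.
move=> m; have -> : A' m = D (m + d) by rewrite /D addrK.
by rewrite DE chrDr //; ring.
Qed.

(** * Images of the generators under an endomorphism *)

Variable f : B -> B.
Hypothesis hf : is_alg_hom f.

Let hrf : is_alg_hom (rho \o f). Proof. exact: alg_hom_comp. Qed.

Lemma endo_z : exists (al : 'I_n -> Zn) (c : 'I_n -> K), forall k, c k != 0 /\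
  rho (f (z k)) = wshift (fun m => c k * chr (al k) m) 0.
Proof.
have /fin_all_exists[ac hac] : forall k, exists ac : Zn * K, ac.2 != 0 /\
    rho (f (z k)) = wshift (fun m => ac.2 * chr ac.1 m) 0.
  move=> k; have [||a [c h]] := @rho_unit (f (z k)) (f (zi k)); last by exists (a, c).
    by rewrite -(alg_homM hf) zzi (alg_hom1 hf).
  by rewrite -(alg_homM hf) ziz (alg_hom1 hf).
by exists (fun k => (ac k).1), (fun k => (ac k).2).
Qed.

(** The commutation of [u] with z_k passes to the images, where z_k has become z^(al k) up to a
    scalar. Injectivity of [qpow] turns the resulting equality of weights into one of exponents. *)
Lemma endo_weight_support (al : 'I_n -> Zn) (c : 'I_n -> K) u i (t : int) :
  (forall k, c k != 0 /\ rho (f (z k)) = wshift (fun m => c k * chr (al k) m) 0) ->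
  (forall k, z k * u = q i ^ (if k == i then t else 0) *: (u * z k)) ->
  exists s, rho (f u) = lincomb (fun ad => rho (monomial ad)) s /\
    forall ad, ad \in supp s -> forall k,
      had (al k) ad.2 = axis i (if k == i then t else 0).
Proof.
move=> hc hu.
have [s es] := normal_monomial_span hq hlam0 hlaminv hq1 rel zzi ziz hB (f u).
have es' : rho (f u) = lincomb (fun ad => rho (monomial ad)) s.
  rewrite es /lincomb (alg_hom_sum hrho); apply: eq_bigr => p _.
  exact: (alg_homZ hrho).
exists s; split=> // ad ads k; apply: (qpow_inj hq hindep).
rewrite qpow_axis // -/(chr (al k) ad.2); apply: (weight_support es') ads.
have [ck ek] := hc k; apply: (scalerI ck).
have -> : c k *: (wshift (chr (al k)) 0 * rho (f u)) = rho (f (z k)) * rho (f u).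
  by rewrite ek -wshiftZ -scalerAl.
rewrite -(alg_homM hrho) -(alg_homM hf) hu (alg_homZ hf) (alg_homZ hrho) (alg_homM hf).
by rewrite (alg_homM hrho) ek -wshiftZ -scalerAr !scalerA mulrC.
Qed.

Lemma endo_xy_neq0 i : f (x i) != 0 /\ f (y i) != 0.
Proof.
have e : f (x i) * f (y i) - q i *: (f (y i) * f (x i)) = 1.
  rewrite -!(alg_homM hf) -(alg_homZ hf) -(alg_homB hf) -(alg_hom1 hf).
  by case: rel => _ ->.
by split; apply/eqP => e0; move/eqP: e;
  rewrite e0 mul0r mulr0 scaler0 subr0 eq_sym oner_eq0.
Qed.

(** Since f(y_i) is nonzero, some degree d occurs in it, and the integer equations (al_k)_j d_j = 1
    if j = k = i, and 0 otherwise, make the exponent matrix diagonal with entries 1 or -1. *)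
Lemma endo_shape : exists (eps : Zn) (c : 'I_n -> K), forall i,
  [/\ eps i = 1 \/ eps i = -1, c i != 0,
      rho (f (z i)) = wshift (fun m => c i * chr (axis i (eps i)) m) 0,
      exists A, spanned torus (wshift A 0) /\
        rho (f (y i)) = wshift A 0 * rho (wpow i (eps i)) &
      exists A, spanned torus (wshift A 0) /\
        rho (f (x i)) = wshift A 0 * rho (wpow i (- eps i))].
Proof.
have [al [c hc]] := endo_z.
have supp_y i : exists s, rho (f (y i)) = lincomb (fun ad => rho (monomial ad)) s /\
    forall ad, ad \in supp s -> forall k,
      had (al k) ad.2 = axis i (if k == i then 1 else 0).
  apply: endo_weight_support hc _ => k; case: eqP => [->|/eqP ki].
    by rewrite expr1z (qweyl_zy hq1 rel).
  by rewrite expr0z scale1r (qweyl_z_comm_y hlam0 hlaminv rel).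
have supp_x i : exists s, rho (f (x i)) = lincomb (fun ad => rho (monomial ad)) s /\
    forall ad, ad \in supp s -> forall k,
      had (al k) ad.2 = axis i (if k == i then -1 else 0).
  apply: endo_weight_support hc _ => k; case: eqP => [->|/eqP ki].
    by rewrite exprN1 (qweyl_xz hq1 rel) scalerA mulVf ?scale1r.
  by rewrite expr0z scale1r (qweyl_z_comm_x hlam0 hlaminv rel).
pose eps : Zn := [ffun i => al i i].
have witness i : exists d : Zn, forall k, had (al k) d = axis i (if k == i then 1 else 0).
  have [s [es hs]] := supp_y i.
  case e: (supp s) => [|ad r]; last by exists ad.2; apply: hs; rewrite e mem_head.
  have [_ /negP[]] := endo_xy_neq0 i; apply/eqP; apply: rho_inj.
  by rewrite es lincombE e big_nil (alg_hom0 hrho).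
have eps1 i : eps i = 1 \/ eps i = -1.
  have -> : eps i = al i i by rewrite ffunE.
  by have [d /(_ i)/ffunP/(_ i)] := witness i; rewrite !ffunE !eqxx => /int_mul_eq1.
(* For the degree d occurring in f(y_i), the equation for k = i gives d_i != 0; the one for k != i
   then gives (al_k)_i = 0. *)
have alE k : al k = axis k (eps k).
  apply/ffunP => i; rewrite !ffunE; case: eqP => [-> //|/eqP ik].
  have [d hd] := witness i; have /ffunP/(_ i) := hd k; have /ffunP/(_ i) := hd i.
  rewrite !ffunE !eqxx (eq_sym k) (negbTE ik).
  move=> ab /eqP; rewrite mulf_eq0 => /orP[/eqP //|/eqP d0].
  by rewrite d0 mulr0 in ab.
have deg (d : Zn) i (t : int) :
    (forall k, had (al k) d = axis i (if k == i then t else 0)) -> d = axis i (eps i * t).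
  move=> hd; apply/ffunP => k; have /ffunP/(_ k) := hd k; have := eps1 k.
  rewrite alE had_axis axisxx !axisE; case: eqP => [->|_].
    by move: (eps i : int) (d i : int) => a b [] ->; lia.
  by move: (eps k : int) (d k : int) => a b [] ->; lia.
exists eps, c => i; have [ci ei] := hc i; split=> //.
- by rewrite ei alE.
- have [s [es hs]] := supp_y i; apply: homogeneous_factor es _ => ad /hs/deg ->.
  by rewrite mulr1.
- have [s [es hs]] := supp_x i; apply: homogeneous_factor es _ => ad /hs/deg ->.
  by rewrite mulrN1.
Qed.

Lemma diag_product A A' p p' d r : wshift p d * wshift p' (- d) = wshift r 0 ->
  (wshift A 0 * wshift p d) * (wshift A' 0 * wshift p' (- d))
    = wshift (fun m => A m * A' (m - d) * r m) 0 :> linop K Zn.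
Proof.
move=> pp'; rewrite !mulrA -(mulrA _ (wshift p d) (wshift A' 0)) (wshift_diagC p d A').
rewrite !mulrA -(mulrA _ (wshift p d)) pp' !wshiftM !addr0; apply: eq_wshift => m.
by rewrite !subr0.
Qed.

(* The scalar [c] is found by evaluating the relation at a point where the diagonal
   operator [w_e w_{-e}] vanishes. *)
Lemma endo_cofactor i (e : int) (c : K) A A' : e = 1 \/ e = -1 ->
  rho (f (z i)) = wshift (fun m => c * chr (axis i e) m) 0 ->
  spanned torus (wshift A 0) -> rho (f (y i)) = wshift A 0 * rho (wpow i e) ->
  spanned torus (wshift A' 0) -> rho (f (x i)) = wshift A' 0 * rho (wpow i (- e)) ->
  (exists b k, k != 0 /\ forall m, A m = k * chr b m) /\
  (exists b k, k != 0 /\ forall m, A' m = k * chr b m).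
Proof.
move=> e1 fz sA fy sA' fx.
have prod : rho (f (y i)) * rho (f (x i))
    = wshift (fun m => (q i - 1)^-1 * (c * chr (axis i e) m - 1)) 0.
  rewrite -(alg_homM hrho) -(alg_homM hf) (qweyl_yxE hq1 rel).
  rewrite (alg_homZ hf) (alg_homB hf) (alg_hom1 hf) (alg_homZ hrho) (alg_homB hrho) fz.
  rewrite (alg_hom1 hrho) -wshift1 -[_ - wshift _ _]addr0 -scaleN1r wshiftZ addr0 wshiftD wshiftZ.
  by apply: eq_wshift => m; rewrite mulN1r.
have ev (k : K) (t : int) : t != 0 ->
    eventually_neq0 (fun m : Zn => (k * q i ^ (t * m i) - 1) / (q i - 1)).
  move=> t0; have [N hN] := affine_power_eventually_neq0 hq hindep i k t0.
  by exists N => m hm; rewrite mulf_neq0 ?invr_eq0 ?hN.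
pose px (m : Zn) := (tau lam i m)^-1 * ((q i ^ (m i + 1) - 1) / (q i - 1)).
case: e1 => e1; rewrite {}e1 in fz fy fx prod.
- pose r (m : Zn) := (1 * q i ^ (1 * m i) - 1) / (q i - 1).
  have wy : rho (wpow i 1) = wshift (tau lam i) (axis i 1) by exact: rho_y.
  have wx : rho (wpow i (-1)) = wshift px (- axis i 1) by rewrite -axisN; exact: rho_x.
  have rE : wshift (tau lam i) (axis i 1) * wshift px (- axis i 1) = wshift r 0.
    rewrite -axisN; apply: etrans (repYX hq hlam0 hindep i) _.
    by apply: eq_wshift => m; rewrite /r !mul1r.
  rewrite {}fy {}fx {}wy {}wx in prod.
  have c1 : c = 1.
    move: prod; rewrite (diag_product _ _ rE) => /wshift_inj/(_ 0).
    rewrite /r ffunE mulr0 expr0z mul1r subrr mul0r mulr0 chr0r // mulr1 => /esym/eqP.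
    by rewrite mulf_eq0 invr_eq0 (negbTE (q1_neq0 i)) subr_eq0 => /eqP.
  apply: (@cofactor_unit A A' _ _ _ (fun=> 1) r 0 1 (oner_neq0 K) _ (ev 1 1 _) sA sA' rE) => //.
    by move=> m; rewrite chr0l mulr1.
  rewrite prod; apply: eq_wshift => m.
  by rewrite c1 chr_axis /r mulr1 mulrC.
- pose r (m : Zn) := (q i * q i ^ (1 * m i) - 1) / (q i - 1).
  have wx : rho (wpow i (-1)) = wshift px (axis i (-1)) by exact: rho_x.
  have wy : rho (wpow i (- -1)) = wshift (tau lam i) (- axis i (-1)).
    by rewrite -axisN opprK; exact: rho_y.
  have rE : wshift px (axis i (-1)) * wshift (tau lam i) (- axis i (-1)) = wshift r 0.
    rewrite -axisN opprK; apply: etrans (repXY q hlam0 i) _; apply: eq_wshift => m.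
    by rewrite /r mul1r expfzDr // expr1z [q i ^ _ * _]mulrC.
  rewrite {}fy {}fx {}wy {}wx in prod.
  have c1 : c = (q i)^-1.
    move: prod; rewrite (diag_product _ _ rE) => /wshift_inj/(_ (axis i (-1))).
    rewrite /r axisxx mul1r exprN1 mulfV // !subrr mul0r mulr0 chr_axis axisxx mulrNN mulr1.
    rewrite expr1z => /esym/eqP.
    rewrite mulf_eq0 invr_eq0 (negbTE (q1_neq0 i)) subr_eq0 => /eqP cq.
    by apply: (mulIf (hq i)); rewrite cq mulVf.
  (* With c = 1/q_i one has c/z_i - 1 = -(q_i z_i)^-1 (q_i z_i - 1), so the unit remaining beside
     [r] is -1/(q_i z_i). *)
  have k0 : - (q i)^-1 != 0 by rewrite oppr_eq0 invr_eq0.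
  apply: (@cofactor_unit A A' _ _ _ (fun m => - (q i)^-1 * chr (axis i (-1)) m)
    r (axis i (-1)) (- (q i)^-1) k0 _ (ev (q i) 1 _) sA sA' rE) => //.
  rewrite prod; apply: eq_wshift => m.
  rewrite c1 chr_axis /r mul1r mulN1r -invr_expz; field.
  by rewrite q1_neq0 hq expfz_neq0.
Qed.

(** * Surjectivity and injectivity *)

Let image u := exists v, f v = u.

Lemma image_subalg : subalg_prop image.
Proof.
split=> [|a u v [u' <-] [v' <-]|u v [u' <-] [v' <-]].
- by exists 1; apply: (alg_hom1 hf).
- by exists (a *: u' + v'); case: hf.
- by exists (u' * v'); apply: (alg_homM hf).
Qed.

Let imageZ a u : image u -> image (a *: u).
Proof. by move=> [v <-]; exists (a *: v); apply: (alg_homZ hf). Qed.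

Let imageM u v : image u -> image v -> image (u * v).
Proof. by case: image_subalg => _ _; apply. Qed.

Let image1 : image 1. Proof. by case: image_subalg. Qed.

Lemma image_ipow u v k : image u -> image v -> image (ipow u v k).
Proof.
move=> hu hv; have hX w m : image w -> image (w ^+ m).
  by move=> hw; elim: m => [|m IH]; rewrite ?expr0 // exprS; apply: imageM.
by case: k => m; apply: hX.
Qed.

Lemma image_zmonomial a : (forall i, image (z i)) -> (forall i, image (zi i)) ->
  image (monomial (a, 0)).
Proof.
move=> iz izi; rewrite /normal_monomial; elim/big_ind: _ => // i _.
rewrite /normal_factor /= [(0 : Zn) i]ffunE /wpow ipow0 mulr1.
exact: image_ipow.
Qed.

(** The cofactor is a scalar times z^b, and the image contains z^(-b), which removes it from
    f(u). *)
Lemma image_cofactor u w A : (forall i, image (z i)) -> (forall i, image (zi i)) ->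
  (exists b k, k != 0 /\ forall m, A m = k * chr b m) ->
  rho (f u) = wshift A 0 * rho w -> image w.
Proof.
move=> iz izi [b [k [k0 AE]]] e; have [k' k'0 eb] := rho_monomial_deg0 (- b).
have -> : w = (k * k')^-1 *: (monomial (- b, 0) * f u).
  apply: rho_inj; rewrite (alg_homZ hrho) (alg_homM hrho) eb e mulrA scalerAl.
  rewrite wshiftM addr0 wshiftZ -[LHS]mul1r -wshift1; congr (_ * _).
  apply: eq_wshift => m; rewrite subr0 AE chrNl //; field.
  by rewrite k0 k'0 chr_neq0.
by apply: imageZ; apply: imageM; [apply: image_zmonomial|exists u].
Qed.

Lemma endo_bijective : bijective f.
Proof.
have [eps [c h]] := endo_shape.
have fz i : f (z i) = c i *: zpow i (eps i).
  have [e1 _ e _ _] := h i; apply: rho_inj; rewrite (alg_homZ hrho) e -wshiftZ; congr (_ *: _).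
  case: e1 => ->; rewrite /zpow.
    by rewrite ipow1 rho_z; apply: eq_wshift => m; rewrite chr_axis.
  by rewrite ipowN1 rho_zi; apply: eq_wshift => m; rewrite chr_axis.
have inv_uniq u v w : u * v = 1 -> w * u = 1 -> v = w :> B.
  by move=> uv wu; rewrite -[v]mul1r -wu -mulrA uv mulr1.
have izzi i : image (z i) /\ image (zi i).
  have [e1 c0 _ _ _] := h i.
  have fzi : f (zi i) = (c i)^-1 *: zpow i (- eps i).
    apply: (inv_uniq (f (z i))); first by rewrite -(alg_homM hf) zzi (alg_hom1 hf).
    rewrite fz -scalerAl -scalerAr scalerA mulVf // scale1r /zpow.
    by case: e1 => ->; rewrite ?opprK ?ipow1 ?ipowN1.
  have i1 : image (zpow i (eps i)).
    by exists ((c i)^-1 *: z i); rewrite (alg_homZ hf) fz scalerA mulVf ?scale1r.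
  have i2 : image (zpow i (- eps i)).
    by exists (c i *: zi i); rewrite (alg_homZ hf) fzi scalerA mulfV ?scale1r.
  by move: i1 i2; case: e1 => ->; rewrite ?opprK.
have iz i : image (z i) by case: (izzi i).
have izi i : image (zi i) by case: (izzi i).
have ixy i : image (x i) /\ image (y i).
  have [e1 c0 ez [A [sA ey]] [A' [sA' ex]]] := h i.
  have [hA hA'] := endo_cofactor e1 ez sA ey sA' ex.
  have i1 := image_cofactor iz izi hA ey; have i2 := image_cofactor iz izi hA' ex.
  by move: i1 i2; case: e1 => ->; rewrite ?opprK.
have surj : forall u, image u.
  apply: (qweyl_localization_ind image_subalg hB zzi ziz) => // i; by case: (ixy i).
have inj : injective f.
  (* Only the degree of f(y_i) matters for injectivity; the cofactor is absorbed into the weight. *)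
  have /fin_all_exists[g hg] : forall i, exists g, rho (f (y i)) = wshift g (axis i (eps i)).
    move=> i; have [_ _ _ [A [_ ->]] _] := h i; have [p ->] := rho_wpow i (eps i).
    by rewrite wshiftM add0r; eexists.
  have /fin_all_exists[g' hg'] : forall i, exists g, rho (f (x i)) = wshift g (axis i (- eps i)).
    move=> i; have [_ _ _ _ [A [_ ->]]] := h i; have [p ->] := rho_wpow i (- eps i).
    by rewrite wshiftM add0r; eexists.
  apply: (inj_compr (f := rho)).
  apply: (graded_hom_inj hq hlam0 hlaminv hindep hB zzi ziz hrf (eps := eps) (cz := c)
    _ _ _ hg hg') => i; have [e1 c0 ez _ _] := h i => //.
  by case: e1 => ->.
have [finv finvP] := choice surj.
by exists finv => // u; apply: inj; rewrite finvP.
Qed.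


End Endomorphism.

Theorem theorem3p1 (K : fieldType) (n : nat) (hn : (1 <= n)%N)
    (q : 'I_n -> K) (lam : 'I_n -> 'I_n -> K)
    (hq : forall i, q i != 0)
    (hlam0 : forall i j, lam i j != 0)
    (hlaminv : forall i j, lam i j = (lam j i)^-1)
    (hlam1 : forall i, lam i i = 1)
    (hindep : forall e : 'I_n -> int, \prod_(i < n) q i ^ e i = 1 -> forall i, e i = 0)
    (B : algType K) (x y : 'I_n -> B)
    (hB : is_qweyl_localization q lam x y) :
  forall f : B -> B, is_alg_hom f -> bijective f.
Proof.
move=> f hf; have [rel hz univ] := hB.
have /fin_all_exists[zi hzi] : forall i, exists v, zgen x y i * v = 1 /\ v * zgen x y i = 1.
  exact: hz.
have zzi i : zgen x y i * zi i = 1 by case: (hzi i).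
have ziz i : zi i * zgen x y i = 1 by case: (hzi i).
(* The universal property, applied to the operators on the lattice, provides the representation. *)
have [rho [hrho rho_x rho_y _]] := univ _ _ _ (rep_rel hq hlam0 hlaminv hindep)
  (rep_zgen_inv hq hlam0 hindep).
exact: (endo_bijective hq hlam0 hlaminv hindep hB zzi ziz hrho rho_x rho_y hf).
Qed.
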